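(* Let $n\ge1$, let $\mathcal{Q}=2n+2$, and let $0<\alpha<\mathcal{Q}/2$. There is a constant $C>0$ depending only on $n$ and $\alpha$ such that for every $g\in L^2(\mathbb{H}^n)$ with $\|g\|_2=1$, every measurable $\Omega\subseteq\mathbb{H}^n\times\mathbb{H}^n$, and every $f\in L^2(\mathbb{H}^n)$, $$\|\chi_\Omega V_gf\|_2^2\le C\,|\Omega|\,\bigl\|\,\|\cdot\|^\alpha f\bigr\|_2\,\bigl\|\,\|\cdot\|^\alpha\mathcal{F}(f)\bigr\|_2.$$
   Context: $\mathbb{H}^n=\mathbb{R}^n\times\mathbb{R}^n\times\mathbb{R}\cong\mathbb{R}^{2n+1}$ is the Heisenberg group with group law $(p,q,t)\cdot(p',q',t')=\left(p+p',q+q',t+t'+\tfrac12(pq'-qp')\right)$, where $pq$ is the Euclidean dot product on $\mathbb{R}^n$. Its Haar measure is Lebesgue measure on $\mathbb{R}^{2n+1}$, so $L^2(\mathbb{H}^n)=L^2(\mathbb{R}^{2n+1})$. $\mathcal{Q}=2n+2$ is its homogeneous dimension. $\mathcal{F}$ is the Euclidean Fourier transform on $\mathbb{R}^{2n+1}$, $\mathcal{F}(h)(Q)=\int_{\mathbb{R}^{2n+1}}h(X)e^{-2\pi i\langle Q,X\rangle}\,dX$, extended to a unitary operator on $L^2(\mathbb{R}^{2n+1})$; here $\langle Q,X\rangle$ is the Euclidean inner product on $\mathbb{R}^{2n+1}$. The short-time Fourier transform of $f\in L^2(\mathbb{H}^n)$ with window $g\in L^2(\mathbb{H}^n)$ is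 $$V_gf(Q,P)=\int_{\mathbb{R}^{2n+1}}\mathcal{F}(f)(X)\,\overline{\mathcal{F}(g)(X\cdot P)}\,e^{-2\pi i\langle Q,X\rangle}\,dX,\qquad Q,P\in\mathbb{H}^n,$$ with $X\cdot P$ the Heisenberg product. For $X=(z,t)\in\mathbb{R}^{2n}\times\mathbb{R}=\mathbb{H}^n$, the Korányi norm is $\|X\|=(|z|^4+t^2)^{1/4}$, with $|z|$ Euclidean; $\|\cdot\|^\alpha h$ is the function $X\mapsto\|X\|^\alpha h(X)$, whose $L^2(\mathbb{H}^n)$ norm may be $+\infty$. $|\Omega|$ is the Lebesgue measure of $\Omega$ (possibly $+\infty$), $\chi_\Omega$ its indicator function; convention $0\cdot\infty=0$. *)

(* Defs.v *)
From HB Require Import structures.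
From mathcomp Require Import all_boot all_order all_algebra.
From mathcomp Require Import all_classical all_reals all_analysis.
From mathcomp Require Import complex.

Set Implicit Arguments.
Unset Strict Implicit.
Unset Printing Implicit Defensive.

Import Order.TTheory GRing.Theory Num.Theory.
Import numFieldNormedType.Exports.

Local Open Scope classical_set_scope.
Local Open Scope ring_scope.
Local Open Scope complex_scope.

(* The sigma-finite instance of [m1 \x m2] is shadowed by the one for products
   of subprobabilities, hence this lemma. *)
Lemma sigma_finite_product d1 d2 (T1 : measurableType d1)
    (T2 : measurableType d2) (R : realType) (m1 : {measure set T1 -> \bar R})
    (m2 : {sigma_finite_measure set T2 -> \bar R}) :
  sigma_finite setT m1 -> sigma_finite setT (m1 \x m2)%E.
Proof.
move=> /sigma_finiteP[F [TF ndF Foo]].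
have /sigma_finiteP[G [TG ndG Goo]] := sigma_finiteT m2.
exists (fun n => F n `*` G n).
  rewrite -setXTT TF TG predeqE => -[x y]; split.
    move=> [/= [n _ Fnx] [k _ Gky]]; exists (maxn n k) => //; split.
    - by move: x Fnx; exact/subsetPset/ndF/leq_maxl.
    - by move: y Gky; exact/subsetPset/ndG/leq_maxr.
  by move=> [n _ []/= ? ?]; split; exists n.
move=> k; have [? ?] := Foo k; have [? ?] := Goo k.
split; first exact: measurableX.
by rewrite product_measure1E// lte_mul_pinfty// ge0_fin_numE.
Qed.

(* Lebesgue measure on R^n, with R^n represented by [n.-tuple R] and its Borel
   (product) sigma-algebra: R^0 carries the unit point mass and R^(n+1) the
   image of lebesgue_measure (x) (Lebesgue measure on R^n) under
   (x, t) |-> x :: t. *)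
Section lebesgue_tuple.
Context {R : realType}.
Local Notation mR := (measurableTypeR R).
Local Open Scope ereal_scope.

Section lebesgue_cons.
Variables (n : nat) (mu : {sigma_finite_measure set (n.-tuple mR) -> \bar R}).

Let cons_pair (p : mR * n.-tuple mR) : n.+1.-tuple mR := [tuple of p.1 :: p.2].

Let measurable_cons_pair : measurable_fun [set: mR * n.-tuple mR] cons_pair.
Proof. exact: measurable_cons. Qed.

Definition lebesgue_cons : set (n.+1.-tuple mR) -> \bar R :=
  pushforward (lebesgue_measure \x mu) cons_pair.

Let mpreimage (A : set (n.+1.-tuple mR)) :
  measurable A -> measurable (cons_pair @^-1` A).
Proof. by move=> mA; rewrite -[X in measurable X]setTI; exact: measurable_cons_pair. Qed.

Let lebesgue_cons0 : lebesgue_cons set0 = 0.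
Proof. by rewrite /lebesgue_cons /pushforward preimage_set0 measure0. Qed.

Let lebesgue_cons_ge0 A : 0 <= lebesgue_cons A.
Proof. exact: measure_ge0. Qed.

Let lebesgue_cons_sigma_additive : semi_sigma_additive lebesgue_cons.
Proof.
move=> F mF tF mUF; rewrite /lebesgue_cons /pushforward preimage_bigcup.
apply: measure_semi_sigma_additive => //.
- by move=> i; exact: mpreimage.
- apply/trivIsetP => i j _ _ ij; rewrite -preimage_setI.
  by move/trivIsetP : tF => /(_ _ _ _ _ ij) ->//; rewrite preimage_set0.
- by rewrite -preimage_bigcup; exact: mpreimage.
Qed.

HB.instance Definition _ := isMeasure.Build _ _ _ lebesgue_cons
  lebesgue_cons0 lebesgue_cons_ge0 lebesgue_cons_sigma_additive.

Let lebesgue_cons_sigma_finite : sigma_finite setT lebesgue_cons.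
Proof.
have [F TF Foo] : sigma_finite setT (lebesgue_measure \x mu).
  exact/sigma_finite_product/sigma_finiteT.
pose s (t : n.+1.-tuple mR) : mR * n.-tuple mR := (thead t, [tuple of behead t]).
have ms : measurable_fun setT s.
  apply: measurable_fun_pair.
    exact: (measurable_tnth ord0).
  exact: measurable_behead.
have sK : cancel cons_pair s.
  by move=> [x t]; congr pair; exact/val_inj.
exists (fun k => s @^-1` F k).
  by rewrite -preimage_bigcup -TF preimage_setT.
move=> k; have [mF Foo'] := Foo k; split.
  by rewrite -[X in measurable X]setTI; exact: ms.
rewrite /lebesgue_cons /pushforward -comp_preimage.
by rewrite (_ : s \o cons_pair = id)//; apply/funext => p; exact: sK.
Qed.

HB.instance Definition _ := Measure_isSigmaFinite.Build _ _ _ lebesgue_cons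
  lebesgue_cons_sigma_finite.

End lebesgue_cons.

Fixpoint lebesgue_tuple (n : nat) :
    {sigma_finite_measure set (n.-tuple mR) -> \bar R} :=
  match n with
  | 0 => \d_ ([tuple] : 0.-tuple mR)
  | m.+1 => lebesgue_cons (lebesgue_tuple m)
  end.

End lebesgue_tuple.

(* The points (p, q, t) of H^n = R^n * R^n * R *)
Notation heisenberg R n := (n.-tuple (measurableTypeR R) * n.-tuple (measurableTypeR R)
    * measurableTypeR R)%type.

Section heisenberg.
Context {R : realType} {n : nat}.
Local Notation H := (heisenberg R n).

Definition dot (p q : n.-tuple R) : R := \sum_(i < n) tnth p i * tnth q i.

Definition addt (p q : n.-tuple R) : n.-tuple R :=
  [tuple tnth p i + tnth q i | i < n].

Definition hmul (X Y : H) : H :=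
  let: (p, q, t) := X in let: (p', q', t') := Y in
  (addt p p', addt q q', t + t' + (dot p q' - dot q p') / 2).

Definition inner (X Y : H) : R :=
  let: (p, q, t) := X in let: (p', q', t') := Y in
  dot p p' + dot q q' + t * t'.

(* (|p|^2 + |q|^2)^2 is |z|^4 for z = (p, q). *)
Definition koranyi (X : H) : R :=
  let: (p, q, t) := X in ((dot p p + dot q q) ^+ 2 + t ^+ 2) `^ (1 / 4).

Definition haar := (lebesgue_tuple n \x lebesgue_tuple n \x @lebesgue_measure R)%E.

HB.instance Definition _ := Measure.on haar.

Let haar_sigma_finite : sigma_finite setT haar.
Proof. exact/sigma_finite_product/sigma_finite_product/sigma_finiteT. Qed.

HB.instance Definition _ := Measure_isSigmaFinite.Build _ _ _ haar
  haar_sigma_finite.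

End heisenberg.
Arguments haar : clear implicits.

Definition homogeneous_dim (n : nat) : nat := (2 * n + 2)%N.

Section complex_integration.
Context d (T : measurableType d) (R : realType).
Variable mu : {measure set T -> \bar R}.
Implicit Types h : T -> R[i].

Definition cmeasurable h :=
  measurable_fun [set: T] (fun x => complex.Re (h x)) /\
  measurable_fun [set: T] (fun x => complex.Im (h x)).

Definition Cintegral h : R[i] :=
  Rintegral mu setT (fun x => complex.Re (h x)) +i*
  Rintegral mu setT (fun x => complex.Im (h x)).

(* p-norm with values in [0, +oo] *)
Definition CLnorm (p : R) h : \bar R :=
  Lnorm mu p%:E (fun x => (ComplexField.Normc.normc (h x))%:E).

(* h is a (Borel) representative of a class in the complex space L^p(mu) *)
Definition inCLp (p : R) h := cmeasurable h /\ (CLnorm p h < +oo)%E.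

End complex_integration.

Section fourier.
Context {R : realType} {n : nat}.
Local Notation H := (heisenberg R n).
Local Notation mu := (haar R n).

(* e^(-2 pi i x) *)
Definition echar (x : R) : R[i] := cos (2 * pi * x) -i* sin (2 * pi * x).

Definition fourier1 (h : H -> R[i]) (Q : H) : R[i] :=
  Cintegral mu (fun X => h X * echar (inner Q X)).

(* hh represents the image of (the class of) h under the continuous extension
   to L^2 of the Fourier transform defined on L^1 /\ L^2. *)
Definition is_fourier2 (h hh : H -> R[i]) :=
  inCLp mu 2 hh /\
  exists u : nat -> H -> R[i],
    [/\ forall k, inCLp mu 1 (u k) /\ inCLp mu 2 (u k),
        CLnorm mu 2 (u k \- h) @[k --> \oo] --> 0%E &
        CLnorm mu 2 (fourier1 (u k) \- hh) @[k --> \oo] --> 0%E].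

(* A representative of the Fourier transform of h in L^2, unique up to equality
   almost everywhere (the default value 0 is only relevant outside L^2). *)
Definition fourier (h : H -> R[i]) : H -> R[i] :=
  xget (fun=> 0) [set hh | is_fourier2 h hh].

Definition stft (g f : H -> R[i]) (QP : H * H) : R[i] :=
  Cintegral mu (fun X =>
    fourier f X * (fourier g (hmul X QP.2))^* * echar (inner QP.1 X)).

Definition koranyi_weight (alpha : R) (h : H -> R[i]) (X : H) : R[i] :=
  (koranyi X `^ alpha)%:C * h X.

Definition restrict_to (A : set (H * H)) (F : H * H -> R[i]) (x : H * H) :
  R[i] := (\1_A x : R)%:C * F x.

End fourier.

Section lebesgue_heisenberg2.
Variables (R : realType) (n : nat).
Local Notation H := (heisenberg R n).
Local Notation mu2 := (haar R n \x haar R n)%E.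

(* Lebesgue measure on H^n * H^n as a complete measure: its sigma-algebra
   consists of all Lebesgue measurable sets, not only of the Borel sets. *)
Definition lebesgue2 := @completed_measure_extension _ (H * H)%type R mu2.

HB.instance Definition _ := Measure.on lebesgue2.

Definition lebesgue2_measurable (A : set (H * H)) : Prop :=
  (mu2^*%mu).-cara.-measurable A.

End lebesgue_heisenberg2.
Arguments lebesgue2 : clear implicits.

(* Main.v *)
Require Import Defs.
From HB Require Import structures.
From mathcomp Require Import all_boot all_order all_algebra.
From mathcomp Require Import all_classical all_reals all_analysis.
From mathcomp Require Import measurable_realfun complex ring lra.

(* Cauchy-Schwarz and the right invariance of Lebesgue measure bound the
   short-time Fourier transform uniformly by [|F f|_2 |F g|_2], so the left-hand
   side is at most [|Omega|] times [|F f|_2 ^ 2] up to constants, by Bessel's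
   inequality for [F g].  It remains to prove the uncertainty principle
   [|F f|_2 ^ 2 <= C | |.|^alpha f |_2 | |.|^alpha F f |_2].

   Fix [r > 0] and split [f] into its restriction [v] to the Koranyi ball of
   radius [r] and a remainder.  Cauchy-Schwarz against [|.|^(- alpha)], square
   integrable on balls because [2 alpha < Q], bounds [F v] pointwise, hence in L^2
   of the ball of radius [1 / r], and Bessel's inequality bounds the remainder;
   outside of that ball [|F f| <= (r |.|)^alpha |F f|].  Since balls of radius [r]
   have measure O(r ^ Q), this gives
   [|F f|^2 <= C r^(- 2 alpha) | |.|^alpha f |^2 + r^(2 alpha) | |.|^alpha F f |^2]
   and [r] can be optimized.

   Constants being irrelevant, Bessel's inequality
   [|F u|_2 ^ 2 <= K |u|_2 ^ 2] on [L^1 /\ L^2] suffices in place of Plancherel's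
   theorem.  It comes from multipliers [W_k -> 1] whose Fourier transforms are
   bounded in [L^1]: [\int W_k |F u| ^ 2] is the quadratic form of the convolution
   by the Fourier transform of [W_k], and Fatou's lemma concludes. *)

Set Implicit Arguments.
Unset Strict Implicit.
Unset Printing Implicit Defensive.

Import Order.TTheory GRing.Theory Num.Theory.
Import numFieldNormedType.Exports.

Local Open Scope classical_set_scope.
Local Open Scope ring_scope.

(** * The parabola kernel on the line *)

Section parabola.
Context {R : realType}.
Local Notation mu := (@lebesgue_measure R).

(** The choice of multipliers shapes the proof. The indicator of an interval has a transform
    decaying like [1 / b], which is not integrable; the parabola [1 - (t / a)^2], truncated where it
    vanishes (the Bochner-Riesz multiplier of order 1), gains one order of decay and still has
    elementary antiderivatives against sines and cosines. Its transform is [O(a / (1 + (a b)^2))],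
    whose integral in [b] does not depend on [a]. Tensor products then serve on [R^n] and on [H^n],
    the constants being multiplied. Transforms are kept real, as cosine and sine integrals, and
    complex functions are split into real and imaginary parts at the cost of factors 2. The
    quadratic form of the kernel is bounded by Schur's test. The transform of an [L^2] function is
    known only as an [L^2] limit, so pointwise information comes from an integrable truncation and
    reaches the limit through energy estimates. The optimal radius requires both weighted norms in
    []0, +oo[]; the remaining cases are treated apart, a vanishing weighted norm forcing the
    function to vanish almost everywhere. *)

Definition parabola (a t : R) : R := Num.max 0 (1 - (t / a) ^+ 2).

Lemma continuous_parabola a : continuous (parabola a).
Proof.
move=> x.
have := @continuous_max R R (cst 0) (fun t => 1 - (t / a) ^+ 2) x; apply; first exact: cvg_cst.
apply: cvgB; first exact: cvg_cst.
by apply: cvgM; (apply: cvgM; [exact: cvg_id|exact: cvg_cst]).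
Qed.

Lemma parabola_ge0 a t : 0 <= parabola a t.
Proof. by rewrite /parabola le_max lexx. Qed.

Lemma parabola_le1 a t : parabola a t <= 1.
Proof. by rewrite /parabola ge_max ler01/= gerBl sqr_ge0. Qed.

Lemma parabola_itv a : 0 < a ->
  parabola a = (fun t => 1 - (t / a) ^+ 2) \_ `[- a, a].
Proof.
move=> a0; apply/funext => t; rewrite patchE /parabola mem_setE in_itv/= -ler_norml.
have -> : (`|t| <= a) = (0 <= 1 - (t / a) ^+ 2).
  rewrite subr_ge0 -[(t / a) ^+ 2]real_normK ?num_real// normrM normfV (gtr0_norm a0).
  rewrite -[X in _ = (_ <= X)](expr1n _ 2) ler_pXn2r ?nnegrE ?divr_ge0 ?(ltW a0)//.
  by rewrite ler_pdivrMr// mul1r.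
by case: ifPn => [h|]; [exact/max_idPr|rewrite -ltNge => h; exact/max_idPl/ltW].
Qed.

Lemma integral_parabola (f F : R -> R) (a : R) : 0 < a ->
  continuous f -> (forall t : R, is_derive t 1 F ((1 - (t / a) ^+ 2) * f t)) ->
  (\int[mu]_t (parabola a t * f t)%R%:E = (F a - F (- a))%R%:E)%E.
Proof.
move=> a0 cf dF.
rewrite parabola_itv//.
transitivity (\int[mu]_(t in `[(- a)%R, a]) ((1 - (t / a) ^+ 2) * f t)%R%:E)%E.
  rewrite [RHS]integral_mkcond; apply: eq_integral => t _.
  by rewrite /patch; case: ifPn => //; rewrite mul0r.
have cF (x : R) : F x @[x --> x] --> F x.
  by apply/differentiable_continuous/derivable1_diffP; exact: ex_derive.
rewrite (@continuous_FTC2 _ _ F)//.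
- lra.
- apply: continuous_subspaceT => x; apply: cvgM; last exact: cf.
  apply: cvgB; first exact: cvg_cst.
  by apply: cvgM; (apply: cvgM; [exact: cvg_id|exact: cvg_cst]).
- split => [x _| |].
  + exact: ex_derive.
  + exact: cvg_at_right_filter.
  + exact: cvg_at_left_filter.
- by move=> x _; rewrite derive1E; exact: derive_val.
Qed.


#[local] Instance is_derive_sinM (b t : R) :
  is_derive t 1 (fun t => sin (b * t)) (b * cos (b * t)).
Proof.
have h : is_derive t 1 (fun t : R => b * t) b.
  by apply: is_derive_eq; rewrite /GRing.scale/= mulr1.
rewrite mulrC.
exact: (@is_derive1_comp R sin (fun t => b * t) t _ _ (is_derive_sin (b * t)) h).
Qed.

#[local] Instance is_derive_cosM (b t : R) :
  is_derive t 1 (fun t => cos (b * t)) (- b * sin (b * t)).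
Proof.
have h : is_derive t 1 (fun t : R => b * t) b.
  by apply: is_derive_eq; rewrite /GRing.scale/= mulr1.
rewrite mulNr mulrC -mulNr.
exact: (@is_derive1_comp R cos (fun t => b * t) t _ _ (is_derive_cos (b * t)) h).
Qed.

Lemma continuousM_cos (b : R) : continuous (fun t => cos (b * t)).
Proof.
move=> t; apply: continuous_comp; last exact: continuous_cos.
by apply: cvgM; [exact: cvg_cst|exact: cvg_id].
Qed.

Lemma continuousM_sin (b : R) : continuous (fun t => sin (b * t)).
Proof.
move=> t; apply: continuous_comp; last exact: continuous_sin.
by apply: cvgM; [exact: cvg_cst|exact: cvg_id].
Qed.

Lemma integral_parabola_sin (a b : R) : 0 < a ->
  (\int[mu]_t (parabola a t * sin (b * t))%R%:E = 0)%E.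
Proof.
move=> a0; have [->|b0] := eqVneq b 0.
  by apply: integral0_eq => x _; rewrite mul0r sin0 mulr0.
(* Antiderivative obtained by repeated integration by parts. It is even in [t], so its values at [a]
   and [- a] cancel. *)
pose G t := - ((1 - (t / a) ^+ 2) * cos (b * t) * b^-1) -
  2 / (a ^+ 2 * b ^+ 2) * t * sin (b * t) - 2 / (a ^+ 2 * b ^+ 3) * cos (b * t).
have dG (t : R) : is_derive t 1 G ((1 - (t / a) ^+ 2) * sin (b * t)).
  rewrite /G; apply: is_derive_eq.
  by rewrite /GRing.scale/=; field; apply/andP; split => //; exact/lt0r_neq0.
rewrite (integral_parabola a0 (@continuousM_sin b) dG).
congr EFin; rewrite /G mulrN sinN cosN; field; apply/andP; split => //; exact/lt0r_neq0.
Qed.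

Lemma integral_parabola_cos (a b : R) : 0 < a -> b != 0 ->
  (\int[mu]_t (parabola a t * cos (b * t))%R%:E =
   (4 * (sin (b * a) - a * b * cos (b * a)) / (a ^+ 2 * b ^+ 3))%R%:E)%E.
Proof.
move=> a0 b0.
(* The same integrations by parts. [G] is now odd, and the parabola vanishes at [a], so only the
   last two terms contribute. *)
pose G t := ((1 - (t / a) ^+ 2) * sin (b * t) * b^-1) -
  2 / (a ^+ 2 * b ^+ 2) * t * cos (b * t) + 2 / (a ^+ 2 * b ^+ 3) * sin (b * t).
have dG (t : R) : is_derive t 1 G ((1 - (t / a) ^+ 2) * cos (b * t)).
  rewrite /G; apply: is_derive_eq.
  by rewrite /GRing.scale/=; field; apply/andP; split => //; exact/lt0r_neq0.
rewrite (integral_parabola a0 (@continuousM_cos b) dG).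
congr EFin; rewrite /G mulrN sinN cosN; field; apply/andP; split => //; exact/lt0r_neq0.
Qed.

Lemma le_integral_parabola (a : R) (f : R -> R) : 0 < a -> continuous f ->
  (forall t, `|f t| <= 1) ->
  (`|\int[mu]_t (parabola a t * f t)%R%:E| <= (2 * a)%R%:E)%E.
Proof.
move=> a0 cf f1.
have mf : measurable_fun setT (fun t : R => (parabola a t * f t)%R).
  apply: continuous_measurable_fun => x; apply: cvgM; last exact: cf.
  exact: continuous_parabola.
apply: (le_trans (le_abse_integral _ _ _)) => //; first exact/measurable_EFinP.
apply: (@le_trans _ _ (\int[mu]_t (\1_(`[(- a)%R, a]) t)%:E)%E).
  apply: ge0_le_integral => //.
  - by apply: measurableT_comp => //; exact/measurable_EFinP.
  - exact/measurable_EFinP.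
  - move=> t _; rewrite lee_fin normrM (ger0_norm (parabola_ge0 _ _)).
    apply: (@le_trans _ _ (parabola a t)).
      by rewrite ler_piMr// parabola_ge0.
    rewrite indicE; case: (boolP (t \in _)) => ta; first exact: parabola_le1.
    by rewrite parabola_itv// patchE (negbTE ta).
rewrite integral_indic// setIT [leLHS]lebesgue_measure_itv/= lte_fin ifT; last lra.
by rewrite -EFinD lee_fin; lra.
Qed.

Lemma abs_sin_le (x : R) : `|sin x| <= `|x|.
Proof.
wlog x0 : x / 0 <= x.
  move=> h; have [/h//|/ltW x0] := leP 0 x.
  by rewrite -normrN -sinN -(normrN x) h// oppr_ge0.
move: x0; rewrite le_eqVlt => /predU1P[<-|x0]; first by rewrite sin0.
have [] := @MVT R sin cos 0 x x0 (fun x _ => is_derive_sin x).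
  by apply: continuous_subspaceT => y; exact: continuous_sin.
move=> c _; rewrite sin0 !subr0 => ->.
by rewrite normrM ler_piMl// ler_norml cos_geN1 cos_le1.
Qed.

(** Two regimes. For [|a b| <= 1] the length [2 a] of the support is enough. For [|a b| > 1] the
    closed form and [|sin (a b) - a b cos (a b)| <= 2 |a b|] give [8 a / (a b)^2], and
    [1 + (a b)^2 <= 2 (a b)^2]. The constant 16 covers both. *)
Lemma parabola_cos_bound (a b : R) : 0 < a ->
  (`|\int[mu]_t (parabola a t * cos (b * t))%R%:E| <=
   (16 * a / (1 + (a * b) ^+ 2))%R%:E)%E.
Proof.
move=> a0; have [ab1|ab1] := leP ((a * b) ^+ 2) 1.
  apply: (le_trans (le_integral_parabola a0 _ _)).
  - exact: continuousM_cos.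
  - by move=> t; rewrite ler_norml cos_geN1 cos_le1.
  - rewrite lee_fin ler_pdivlMr; last by have := sqr_ge0 (a * b); lra.
    nra.
have b0 : b != 0 by apply: contraTneq ab1 => ->; rewrite mulr0 expr0n/= ltNge ler01.
rewrite integral_parabola_cos//= lee_fin.
have ab0 : 0 < `|a * b| by rewrite normr_gt0 mulf_neq0// gt_eqF.
have e1 : `|sin (b * a) - a * b * cos (b * a)| <= 2 * `|a * b|.
  rewrite (le_trans (ler_normB _ _))// mulr_natl mulr2n lerD//.
    by rewrite mulrC abs_sin_le.
  by rewrite normrM ler_piMr// ler_norml cos_geN1 cos_le1.
rewrite normrM normfV normrM normr_nat.
have -> : `|a ^+ 2 * b ^+ 3| = `|a * b| ^+ 3 / a.
  rewrite -[X in _ = _ / X](gtr0_norm a0) -normrX -normf_div; congr (`| _ |).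
  by field; exact: lt0r_neq0.
have ab2 : `|a * b| ^+ 2 = (a * b) ^+ 2 by rewrite real_normK// num_real.
rewrite invf_div -ab2 mulrA ler_pdivrMr ?exprn_gt0//.
rewrite [leRHS]mulrAC ler_pdivlMr; last by rewrite ltr_wpDr// sqr_ge0.
rewrite -ab2 in ab1.
set u := `|a * b| in ab0 e1 ab1 *; set v := `|_ - _| in e1 *.
apply: (@le_trans _ _ (4 * (2 * u) * a * (1 + u ^+ 2))).
  by do 2 (apply: ler_wpM2r; [nra|]); lra.
have : 1 + u ^+ 2 <= 2 * u ^+ 2 by lra.
move=> /(ler_wpM2l (_ : 0 <= 8 * u * a)) => /(_ ltac:(nra)) h.
by apply: le_trans (le_trans h _); rewrite le_eqVlt; apply/orP; left; apply/eqP; ring.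
Qed.

End parabola.

(** * Translation invariance of Lebesgue measure on the line *)

Section translation.
Context {R : realType}.
Local Notation mR := (measurableTypeR R).
Local Notation mu := (@lebesgue_measure R).

Let shift (a : R) : mR -> mR := +%R^~ a.

Let measurable_shift a : measurable_fun setT (shift a).
Proof. exact: measurable_funD. Qed.

(** The image measure gives every half-open interval its length, and this characterizes Lebesgue
    measure. *)
Let lebesgue_measure_shift (a : R) (A : set mR) : measurable A ->
  pushforward mu (shift a) A = mu A.
Proof.
move=> mA.
pose s : {mfun mR >-> mR} := HB.pack (shift a)
  (isMeasurableFun.Build _ _ _ _ _ (measurable_shift a)).
apply/esym/(@lebesgue_measure_unique R (pushforward mu s)) => //= _ [[x y]] _ <-.
rewrite /pushforward/= (_ : _ @^-1` _ = `](x - a), (y - a)]%classic); last first.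
  by apply/seteqP; split => t/=; rewrite /shift !in_itv/= ltrBlDr lerBrDr.
rewrite !lebesgue_measure_itv/= !lte_fin ltrD2r; case: ifPn => // _.
by rewrite -!EFinB opprB addrA subrK.
Qed.

Lemma ge0_integral_shift (a : R) (f : mR -> \bar R) :
  measurable_fun setT f -> (forall x, 0 <= f x)%E ->
  (\int[mu]_x f (x + a)%R = \int[mu]_x f x)%E.
Proof.
move=> mf f0; transitivity (\int[pushforward mu (shift a)]_x f x)%E.
  by rewrite ge0_integral_pushforward.
by apply: eq_measure_integral => A mA _; exact: lebesgue_measure_shift.
Qed.

End translation.

Lemma integral_oneDsqrM (R : realType) (c : R) : 0 < c ->
  (\int[lebesgue_measure]_y (1 + (c * y) ^+ 2)^-1%:E = (pi / c)%:E)%E.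
Proof.
move=> c0.
have cf : continuous (fun y : R => (1 + (c * y) ^+ 2)^-1).
  move=> x; apply: cvgV; first by rewrite lt0r_neq0// ltr_pwDl// sqr_ge0.
  apply: cvgD; first exact: cvg_cst.
  by apply: cvgM; (apply: cvgM; [exact: cvg_cst|exact: cvg_id]).
have f0 (y : R) : 0 <= (1 + (c * y) ^+ 2)^-1 by rewrite invr_ge0 addr_ge0 ?sqr_ge0.
rewrite ge0_symfun_integralT//; last by move=> y/=; rewrite mulrN sqrrN.
have dF (y : R) : is_derive y 1 (fun y => atan (c * y) * c^-1) ((1 + (c * y) ^+ 2)^-1).
  have h : is_derive y 1 (fun t : R => c * t) c.
    by apply: is_derive_eq; rewrite /GRing.scale/= mulr1.
  have := is_derive1_comp (is_derive1_atan (c * y)) h.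
  move=> ?; apply: is_derive_eq.
  rewrite scaler0 add0r /GRing.scale/= mulrC mulfK//.
  exact: lt0r_neq0.
have cF : continuous (fun y : R => atan (c * y) * c^-1).
  by move=> x; apply/differentiable_continuous/derivable1_diffP; exact: ex_derive.
rewrite -set_itvcy (@ge0_continuous_FTC2y _ _ (fun y => atan (c * y) * c^-1) _ (pi / 2 / c))//.
- by rewrite mulr0 atan0 mul0r sube0 -EFinM; congr EFin; field; exact: lt0r_neq0.
- exact: continuous_subspaceT.
- have h : atan (c * y) @[y --> +oo] --> (pi / 2 : R).
    apply: (cvg_comp ( *%R c) (@atan R) _ (@cvgy_atan R)).
    by apply: gt0_cvgMry => //; exact: cvg_id.
  by apply: cvgM; [exact: h|exact: cvg_cst].
- by apply: cvg_at_right_filter; exact: cF.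
- by move=> x _; rewrite derive1E; exact: derive_val.
Qed.

(** * Summability kernels and their products *)

Section integral_product.
Local Open Scope ereal_scope.
Context d1 d2 (T1 : measurableType d1) (T2 : measurableType d2) (R : realType).
Variable m1 : {sigma_finite_measure set T1 -> \bar R}.
Variable m2 : {sigma_finite_measure set T2 -> \bar R}.

Lemma measurable_fun_integral2 (f : T1 * T2 -> \bar R) : measurable_fun setT f ->
  measurable_fun setT (fun x => \int[m2]_y f (x, y)).
Proof.
move=> mf; rewrite (_ : (fun x => _) = (fun x => \int[m2]_y f^\+ (x, y)) \-
    (fun x => \int[m2]_y f^\- (x, y))); last first.
  apply/funext => x; rewrite [LHS]integralE.
  under eq_integral do rewrite funepos_comp/=.
  by under [X in _ - X = _]eq_integral do rewrite funeneg_comp/=.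
apply: emeasurable_funB; apply: measurable_fun_fubini_tonelli_F => //.
  exact: measurable_funepos.
exact: measurable_funeneg.
Qed.

Lemma integrable_prod (f : T1 -> R) (g : T2 -> R) :
  m1.-integrable setT (EFin \o f) -> m2.-integrable setT (EFin \o g) ->
  (m1 \x m2).-integrable setT (fun z => (f z.1 * g z.2)%:E).
Proof.
move=> /integrableP[/measurable_EFinP mf fi] /integrableP[/measurable_EFinP mg gi].
have mfg : measurable_fun setT (fun z : T1 * T2 => (f z.1 * g z.2)%:E).
  by apply/measurable_EFinP/measurable_funM; exact: measurableT_comp.
apply/(@integrable12ltyP _ _ _ _ _ m1 m2 _ mfg) => /=.
rewrite (_ : (fun x => _) = (fun x => `|(f x)%:E| * \int[m2]_y `|(g y)%:E|)); last first.
  apply/funext => x; rewrite -ge0_integralZl//.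
    by apply: eq_integral => y _; rewrite /= normrM EFinM.
  by apply: measurableT_comp => //; exact/measurable_EFinP.
rewrite ge0_integralZr//; last 2 first.
  by apply: measurableT_comp => //; exact/measurable_EFinP.
  exact: integral_ge0.
by apply: lte_mul_pinfty => //; [exact: integral_ge0|rewrite ge0_fin_numE//; exact: integral_ge0].
Qed.

Lemma integral_prod (f : T1 -> R) (g : T2 -> R) :
  m1.-integrable setT (EFin \o f) -> m2.-integrable setT (EFin \o g) ->
  \int[m1 \x m2]_z (f z.1 * g z.2)%:E = (\int[m1]_x (f x)%:E) * (\int[m2]_y (g y)%:E).
Proof.
move=> fi gi; rewrite -integral12_prod_meas1; last exact: integrable_prod.
rewrite /fubini_F/=.
rewrite (_ : (fun x => _) = (fun x => (f x)%:E * (\int[m2]_y (g y)%:E))); last first.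
  by apply/funext => x; under eq_integral do rewrite EFinM; rewrite integralZl.
have /fineK <- : \int[m2]_y (g y)%:E \is a fin_num by exact: integrable_fin_num.
by rewrite integralZr.
Qed.

End integral_product.

Lemma integrable_mul_bounded d (T : measurableType d) (R : realType)
    (mu : {measure set T -> \bar R}) (w h : T -> R) :
  mu.-integrable setT (EFin \o w) -> measurable_fun setT h ->
  (forall x, `|h x| <= 1) -> mu.-integrable setT (fun x => (w x * h x)%:E).
Proof.
move=> wi mh h1; apply: (le_integrable measurableT _ _ wi).
  apply/measurable_EFinP/measurable_funM => //.
  by apply/measurable_EFinP; exact: measurable_int wi.
by move=> x _; rewrite lee_fin normrM ler_piMr.
Qed.

Lemma measurable_sin (R : realType) : measurable_fun setT (@sin R).
Proof. by apply: continuous_measurable_fun; exact: continuous_sin. Qed.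

Lemma measurable_cos (R : realType) : measurable_fun setT (@cos R).
Proof. by apply: continuous_measurable_fun; exact: continuous_cos. Qed.

Lemma sin_le1_norm (R : realType) (x : R) : `|sin x| <= 1.
Proof. by rewrite ler_norml sin_geN1 sin_le1. Qed.

Lemma cos_le1_norm (R : realType) (x : R) : `|cos x| <= 1.
Proof. by rewrite ler_norml cos_geN1 cos_le1. Qed.

Section summability_kernel.
Local Open Scope ereal_scope.
Context d (T : measurableType d) (R : realType).
Variables (mu : {sigma_finite_measure set T -> \bar R}) (phi : T -> T -> R).

(** For [phi xi x = 2 pi <xi, x>] and even [W], this is the Fourier transform of [W] at [x - y]; the
    Dirichlet kernel is the case of the indicator of an interval. Keeping two points makes sense of
    it for an abstract phase. *)
Definition dirichlet (W : T -> R) (x y : T) : \bar R :=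
  \int[mu]_xi (W xi * cos (phi xi x - phi xi y))%:E.

(* [phi] plays the role of [2 pi <xi, x>].  The multipliers [W k] tend to 1 and the
   kernels [dirichlet (W k)] are uniformly bounded in L^1; the vanishing of the sine
   part, that is, evenness of [W k], makes these conditions stable under products. *)
Record summability_kernel (K : R) (W : nat -> T -> R) : Prop := {
  sk_phi : measurable_fun setT (fun z : T * T => phi z.1 z.2) ;
  sk_bound_ge0 : (0 <= K)%R ;
  sk_ge0 : forall k x, (0 <= W k x)%R ;
  sk_int : forall k, mu.-integrable setT (EFin \o W k) ;
  sk_cvg : forall x, (W k x @[k --> \oo] --> (1 : R))%R ;
  sk_sin : forall k x y,
    \int[mu]_xi (W k xi * sin (phi xi x - phi xi y))%:E = 0 ;
  sk_cos : forall k x, \int[mu]_y `|dirichlet (W k) x y| <= K%:E }.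

Lemma measurable_phi1 x : measurable_fun setT (fun z : T * T => phi z.1 z.2) ->
  measurable_fun setT (phi ^~ x).
Proof.
move=> mphi; exact: (measurableT_comp mphi (g := fun xi => (xi, x)) (pair2_measurable x)).
Qed.

Section theory.
Variables (K : R) (W : nat -> T -> R).
Hypothesis sk : summability_kernel K W.

Lemma sk_measurable k : measurable_fun setT (W k).
Proof. by apply/measurable_EFinP; exact: measurable_int (sk_int sk k). Qed.

Lemma measurable_phi_sub x y : measurable_fun setT (fun xi => phi xi x - phi xi y)%R.
Proof. by apply: measurable_funB; exact: (measurable_phi1 _ (sk_phi sk)). Qed.

Lemma integrable_sk_cos k x y :
  mu.-integrable setT (fun xi => (W k xi * cos (phi xi x - phi xi y))%:E).
Proof.
apply: integrable_mul_bounded; first exact: (sk_int sk).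
  by apply: measurableT_comp; [exact: measurable_cos|exact: measurable_phi_sub].
by move=> ?; exact: cos_le1_norm.
Qed.

Lemma integrable_sk_sin k x y :
  mu.-integrable setT (fun xi => (W k xi * sin (phi xi x - phi xi y))%:E).
Proof.
apply: integrable_mul_bounded; first exact: (sk_int sk).
  by apply: measurableT_comp; [exact: measurable_sin|exact: measurable_phi_sub].
by move=> ?; exact: sin_le1_norm.
Qed.

Lemma dirichletC k x y : dirichlet (W k) x y = dirichlet (W k) y x.
Proof. by apply: eq_integral => xi _; rewrite -cosN opprB. Qed.

Lemma measurable_dirichlet k :
  measurable_fun setT (fun z : T * T => dirichlet (W k) z.1 z.2).
Proof.
apply: (@measurable_fun_integral2 _ _ _ _ _ mu (fun z : (T * T) * T =>
   (W k z.2 * cos (phi z.2 z.1.1 - phi z.2 z.1.2))%:E)).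
have m11 : measurable_fun setT (fun z : (T * T) * T => z.1.1).
  by apply: measurableT_comp.
have m12 : measurable_fun setT (fun z : (T * T) * T => z.1.2).
  by apply: measurableT_comp.
apply/measurable_EFinP/measurable_funM.
  by apply: measurableT_comp; [exact: sk_measurable|].
apply: measurableT_comp; first exact: measurable_cos.
apply: measurable_funB.
  apply: (measurableT_comp (sk_phi sk) (g := fun z : (T * T) * T => (z.2, z.1.1))).
  exact: measurable_fun_pair.
apply: (measurableT_comp (sk_phi sk) (g := fun z : (T * T) * T => (z.2, z.1.2))).
exact: measurable_fun_pair.
Qed.

End theory.

End summability_kernel.

Section product.
Local Open Scope ereal_scope.
Context d1 d2 (T1 : measurableType d1) (T2 : measurableType d2) (R : realType).
Variable m1 : {sigma_finite_measure set T1 -> \bar R}.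
Variable m2 : {sigma_finite_measure set T2 -> \bar R}.

Definition sigma_finite_prod : {sigma_finite_measure set (T1 * T2)%type -> \bar R} :=
  HB.pack (m1 \x m2) (Measure_isSigmaFinite.Build _ _ _ (m1 \x m2)
    (sigma_finite_product m2 (sigma_finiteT m1))).

Variables (phi1 : T1 -> T1 -> R) (phi2 : T2 -> T2 -> R).
Variables (K1 K2 : R) (W1 : nat -> T1 -> R) (W2 : nat -> T2 -> R).
Hypothesis sk1 : summability_kernel m1 phi1 K1 W1.
Hypothesis sk2 : summability_kernel m2 phi2 K2 W2.

Let W k (z : T1 * T2) := (W1 k z.1 * W2 k z.2)%R.
Let phi (x y : T1 * T2) := (phi1 x.1 y.1 + phi2 x.2 y.2)%R.

(** Addition formula for the cosine: the product of the two sine integrals is zero by [sk_sin], so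
    only the product of the cosine integrals remains. *)
Let dirichlet_prod k x y : dirichlet sigma_finite_prod phi (W k) x y =
  dirichlet m1 phi1 (W1 k) x.1 y.1 * dirichlet m2 phi2 (W2 k) x.2 y.2.
Proof.
rewrite /dirichlet.
pose f1 xi := (W1 k xi * cos (phi1 xi x.1 - phi1 xi y.1))%R.
pose g1 xi := (W1 k xi * sin (phi1 xi x.1 - phi1 xi y.1))%R.
pose f2 xi := (W2 k xi * cos (phi2 xi x.2 - phi2 xi y.2))%R.
pose g2 xi := (W2 k xi * sin (phi2 xi x.2 - phi2 xi y.2))%R.
transitivity (\int[m1 \x m2]_z ((f1 z.1 * f2 z.2)%:E - (g1 z.1 * g2 z.2)%:E)).
  apply: eq_integral => -[u v] _; rewrite /W /phi/= -EFinB; congr EFin.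
  by rewrite opprD addrACA cosD /f1 /f2 /g1 /g2/=; ring.
have f1i := integrable_sk_cos sk1 k x.1 y.1.
have f2i := integrable_sk_cos sk2 k x.2 y.2.
have g1i := integrable_sk_sin sk1 k x.1 y.1.
have g2i := integrable_sk_sin sk2 k x.2 y.2.
rewrite integralB//; [|exact: integrable_prod|exact: integrable_prod].
by rewrite !integral_prod// /g1 (sk_sin sk1) mul0e sube0.
Qed.

Lemma summability_kernel_prod :
  summability_kernel sigma_finite_prod phi (K1 * K2) W.
Proof.
split.
- rewrite /phi/=; apply: measurable_funD.
    apply: (measurableT_comp (sk_phi sk1)
      (g := fun z : (T1 * T2) * (T1 * T2) => (z.1.1, z.2.1))).
    by apply: measurable_fun_pair; exact: measurableT_comp.
  apply: (measurableT_comp (sk_phi sk2)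
    (g := fun z : (T1 * T2) * (T1 * T2) => (z.1.2, z.2.2))).
  by apply: measurable_fun_pair; exact: measurableT_comp.
- by rewrite mulr_ge0// ?(sk_bound_ge0 sk1) ?(sk_bound_ge0 sk2).
- by move=> k x; rewrite mulr_ge0// ?(sk_ge0 sk1) ?(sk_ge0 sk2).
- by move=> k; apply: integrable_prod; [exact: (sk_int sk1)|exact: (sk_int sk2)].
- move=> x; rewrite -[X in _ --> X]mulr1.
  by apply: cvgM; [exact: (sk_cvg sk1)|exact: (sk_cvg sk2)].
- move=> k x y.
  pose f1 xi := (W1 k xi * cos (phi1 xi x.1 - phi1 xi y.1))%R.
  pose g1 xi := (W1 k xi * sin (phi1 xi x.1 - phi1 xi y.1))%R.
  pose f2 xi := (W2 k xi * cos (phi2 xi x.2 - phi2 xi y.2))%R.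
  pose g2 xi := (W2 k xi * sin (phi2 xi x.2 - phi2 xi y.2))%R.
  transitivity (\int[m1 \x m2]_z ((g1 z.1 * f2 z.2)%:E + (f1 z.1 * g2 z.2)%:E)).
    apply: eq_integral => -[u v] _; rewrite /W /phi/= -EFinD; congr EFin.
    by rewrite opprD addrACA sinD /f1 /f2 /g1 /g2/=; ring.
  have f1i := integrable_sk_cos sk1 k x.1 y.1.
  have f2i := integrable_sk_cos sk2 k x.2 y.2.
  have g1i := integrable_sk_sin sk1 k x.1 y.1.
  have g2i := integrable_sk_sin sk2 k x.2 y.2.
  rewrite integralD//; [|exact: integrable_prod|exact: integrable_prod].
  by rewrite !integral_prod// /g1 /g2 (sk_sin sk1) (sk_sin sk2) mul0e mule0 add0e.
- move=> k x.
  have md1 : measurable_fun setT (fun y => `|dirichlet m1 phi1 (W1 k) x.1 y|).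
    apply: measurableT_comp => //.
    exact: (measurableT_comp (measurable_dirichlet sk1 k) (g := fun y => (x.1, y))
      (pair1_measurable _)).
  have md2 : measurable_fun setT (fun y => `|dirichlet m2 phi2 (W2 k) x.2 y|).
    apply: measurableT_comp => //.
    exact: (measurableT_comp (measurable_dirichlet sk2 k) (g := fun y => (x.2, y))
      (pair1_measurable _)).
  rewrite (_ : (fun y => _) = (fun y => `|dirichlet m1 phi1 (W1 k) x.1 y.1| *
    `|dirichlet m2 phi2 (W2 k) x.2 y.2|)); last first.
    by apply/funext => y; rewrite dirichlet_prod abseM.
  rewrite [leLHS]fubini_tonelli1; last 2 first.
    apply: emeasurable_funM.
      exact: (measurableT_comp md1 measurable_fst).
    exact: (measurableT_comp md2 measurable_snd).
    by move=> y; rewrite mule_ge0.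
  rewrite /fubini_F/=.
  under eq_integral do rewrite ge0_integralZl//.
  rewrite ge0_integralZr//; last exact: integral_ge0.
  rewrite EFinM; apply: lee_pmul; [exact: integral_ge0|exact: integral_ge0| |].
    exact: (sk_cos sk1).
  exact: (sk_cos sk2).
Qed.

End product.

(** * The kernel on the line *)

Section line.
Context {R : realType}.
Local Notation mR := (measurableTypeR R).
Local Notation mu := (@lebesgue_measure R).

Lemma measurable_parabola (a : R) : measurable_fun setT (parabola a).
Proof. by apply: continuous_measurable_fun; exact: continuous_parabola. Qed.

Lemma integrable_parabola (a : R) : 0 < a -> mu.-integrable setT (EFin \o parabola a).
Proof.
move=> a0; apply/integrableP; split.
  by apply/measurable_EFinP; exact: measurable_parabola.
have h : (`|\int[mu]_t (parabola a t * cst 1 t)%R%:E| <= (2 * a)%R%:E)%E.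
  apply: le_integral_parabola => // [x|t]; first exact: cvg_cst.
  by rewrite normr1.
apply: le_lt_trans (ltry (2 * a)); apply: le_trans h.
rewrite gee0_abs; last first.
  by apply: integral_ge0 => t _; rewrite /= mulr1 lee_fin parabola_ge0.
rewrite le_eqVlt; apply/orP; left; apply/eqP/eq_integral => t _.
by rewrite /= mulr1 ger0_norm// parabola_ge0.
Qed.

Lemma cvg_parabola (x : R) : parabola k.+1%:R x @[k --> \oo] --> (1 : R).
Proof.
have p0 : parabola 1 0 = 1 :> R.
  by rewrite /parabola mul0r expr0n/= subr0; apply/max_idPr/ler01.
(* By dilation the limit is that of [parabola 1] at [x / (k + 1)], and continuity at 0 gives it. *)
rewrite (_ : (fun k => _) = (fun k => parabola 1 (x * harmonic k))); last first.
  by apply/funext => k; rewrite /parabola /harmonic/= divr1.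
have h : x * harmonic k @[k --> \oo] --> (0 : R).
  rewrite -[X in _ --> X](mulr0 x); apply: cvgM; first exact: cvg_cst.
  exact: cvg_harmonic.
rewrite -[X in _ --> X]p0.
exact: (cvg_comp (fun k => x * harmonic k) (parabola 1) h (@continuous_parabola R 1 0)).
Qed.

(** The constant 8 is the integral over [y] of [16 a / (1 + (2 pi a y)^2)], the bound of
    [parabola_cos_bound] at the frequency [2 pi y]: it is [16 a * pi / (2 pi a)], whatever [a] is.
    The index is [k.+1] so that [a] is positive. *)
Lemma summability_kernel_line :
  summability_kernel mu (fun xi x : mR => 2 * pi * (xi * x))%R 8
    (fun k => parabola k.+1%:R : mR -> R).
Proof.
have phiE (xi x y : R) : 2 * pi * (xi * x) - 2 * pi * (xi * y) =
  (2 * pi * (x - y)) * xi by ring.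
split.
- apply: measurable_funM; first exact: measurable_cst.
  by apply: measurable_funM; [exact: measurable_fst|exact: measurable_snd].
- by [].
- by move=> k x; exact: parabola_ge0.
- by move=> k; exact: integrable_parabola.
- exact: cvg_parabola.
- move=> k x y; rewrite -[RHS](@integral_parabola_sin R k.+1%:R (2 * pi * (x - y)))//.
  by apply: eq_integral => xi _; rewrite phiE.
- move=> k x; set a : R := k.+1%:R; have a0 : 0 < a by rewrite ltr0n.
  have c0 : 0 < 2 * pi * a by rewrite !mulr_gt0 ?pi_gt0.
  pose g (y : R) := (16 * a * (1 + (2 * pi * a * y) ^+ 2)^-1)%R%:E.
  have mh : measurable_fun setT (fun y : mR => (1 + (2 * pi * a * y) ^+ 2)^-1).
    apply: continuous_measurable_fun => y.
    apply: cvgV; first by rewrite lt0r_neq0// ltr_pwDl// sqr_ge0.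
    apply: cvgD; first exact: cvg_cst.
    by apply: cvgM; (apply: cvgM; [exact: cvg_cst|exact: cvg_id]).
  have mg : measurable_fun setT (g : mR -> \bar R).
    by apply/measurable_EFinP; apply: measurable_funM; first exact: measurable_cst.
  have g0 y : (0 <= g y)%E.
    by rewrite lee_fin mulr_ge0 ?invr_ge0 ?addr_ge0 ?sqr_ge0// mulr_ge0// ltW.
  apply: (@le_trans _ _ (\int[mu]_y g (y + - x)%R)%E).
    apply: ge0_le_integral => //.
    + apply: measurableT_comp => //.
      apply: (@measurable_fun_integral2 _ _ _ _ _ mu (fun z : mR * mR =>
        (parabola k.+1%:R z.2 * cos (2 * pi * (z.2 * x) - 2 * pi * (z.2 * z.1)))%:E)).
      apply/measurable_EFinP/measurable_funM.
        by apply: (measurableT_comp (measurable_parabola _)).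
      apply: (measurableT_comp (@measurable_cos R)).
      apply: measurable_funB; (apply: measurable_funM; [exact: measurable_cst|]).
        by apply: measurable_funM; [exact: measurable_snd|exact: measurable_cst].
      by apply: measurable_funM; [exact: measurable_snd|exact: measurable_fst].
    + apply: (measurableT_comp mg).
      exact: measurable_funD.
    + move=> y _; rewrite /dirichlet.
      under eq_integral do rewrite phiE.
      apply: (le_trans (parabola_cos_bound _ a0)); rewrite /g lee_fin.
      by rewrite le_eqVlt; apply/orP; left; apply/eqP; congr (_ / (1 + _)); ring.
  rewrite ge0_integral_shift// /g.
  under eq_integral do rewrite EFinM.
  rewrite ge0_integralZl//; last 3 first.
  + exact/measurable_EFinP.
  + by move=> y _; rewrite lee_fin invr_ge0 addr_ge0 ?sqr_ge0.
  + by rewrite lee_fin mulr_ge0// ltW.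
  rewrite integral_oneDsqrM// -EFinM lee_fin.
  have E (p b : R) : 0 < p -> 0 < b -> 16 * b * (p / (2 * p * b)) = 8.
    by move=> /lt0r_neq0 p0 /lt0r_neq0 b0; field; rewrite b0 p0.
  by rewrite E// pi_gt0.
Qed.

End line.

(** * Transport of kernels, and the kernel on the Heisenberg group *)

Section transport.
Local Open Scope ereal_scope.
Context d1 d2 (T1 : measurableType d1) (T2 : measurableType d2) (R : realType).
Variable m1 : {sigma_finite_measure set T1 -> \bar R}.
Variable m2 : {sigma_finite_measure set T2 -> \bar R}.
Variables (F : T1 -> T2) (G : T2 -> T1).
Hypothesis mF : measurable_fun setT F.
Hypothesis mG : measurable_fun setT G.
Hypothesis FK : cancel F G.
Hypothesis m2E : forall A, measurable A -> m2 A = pushforward m1 F A.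

Lemma integral_transport (f : T2 -> \bar R) : measurable_fun setT f ->
  \int[m2]_y f y = \int[m1]_x f (F x).
Proof.
move=> mf; transitivity (\int[pushforward m1 F]_y f y).
  by apply: eq_measure_integral => A mA _; exact: m2E.
rewrite integralE [RHS]integralE.
rewrite (ge0_integral_pushforward mF _ measurableT (measurable_funepos mf))//.
rewrite (ge0_integral_pushforward mF _ measurableT (measurable_funeneg mf))// preimage_setT.
under [X in _ = X - _]eq_integral do rewrite funepos_comp/=.
by under [X in _ = _ - X]eq_integral do rewrite funeneg_comp/=.
Qed.

(** Serves twice: for [(x, t) |-> x :: t], whose image measure defines [lebesgue_tuple n.+1], and
    for the identity, to pass from iterated [sigma_finite_prod] to [haar]. *)
Lemma summability_kernel_transport (phi1 : T1 -> T1 -> R) (phi2 : T2 -> T2 -> R)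
    (K : R) (W : nat -> T1 -> R) :
  (forall x y, phi2 x y = phi1 (G x) (G y)) ->
  summability_kernel m1 phi1 K W ->
  summability_kernel m2 phi2 K (fun k => W k \o G).
Proof.
move=> phiE sk.
have mphi : measurable_fun setT (fun z : T2 * T2 => phi2 z.1 z.2).
  under eq_fun do rewrite phiE.
  apply: (measurableT_comp (sk_phi sk) (g := fun z : T2 * T2 => (G z.1, G z.2))).
  apply: measurable_fun_pair; first exact: (measurableT_comp mG measurable_fst).
  exact: (measurableT_comp mG measurable_snd).
have mW k : measurable_fun setT (W k \o G).
  by apply: measurableT_comp => //; exact: sk_measurable sk k.
have mWh k (h : R -> R) x y : measurable_fun setT h ->
    measurable_fun setT (fun xi => ((W k \o G) xi * h (phi2 xi x - phi2 xi y))%:E).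
  move=> mh; apply/measurable_EFinP/measurable_funM => //.
  apply: measurableT_comp => //.
  by apply: measurable_funB; exact: (measurable_phi1 _ mphi).
have tr k (h : R -> R) x y : measurable_fun setT h ->
    \int[m2]_xi ((W k \o G) xi * h (phi2 xi x - phi2 xi y))%:E =
    \int[m1]_xi (W k xi * h (phi1 xi (G x) - phi1 xi (G y)))%:E.
  move=> mh; rewrite integral_transport; last exact: mWh.
  by apply: eq_integral => xi _; rewrite /= !phiE FK.
split => //.
- exact: (sk_bound_ge0 sk).
- by move=> k x; exact: (sk_ge0 sk).
- move=> k; apply/integrableP; split; first exact/measurable_EFinP.
  rewrite integral_transport; last first.
    by apply: measurableT_comp => //; exact/measurable_EFinP.
  have /integrableP[_] := sk_int sk k.
  by under [X in _ -> X < _]eq_integral do rewrite /= FK.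
- by move=> x; exact: (sk_cvg sk).
- by move=> k x y; rewrite tr ?(sk_sin sk)//; exact: measurable_sin.
- move=> k x.
  have dE y : dirichlet m2 phi2 (W k \o G) x y = dirichlet m1 phi1 (W k) (G x) (G y).
    by rewrite /dirichlet tr//; exact: measurable_cos.
  under eq_integral do rewrite dE.
  rewrite integral_transport.
    by under eq_integral do rewrite FK; exact: (sk_cos sk).
  apply: measurableT_comp => //.
  exact: (measurableT_comp (measurable_dirichlet sk k)
    (measurable_fun_pair (measurable_cst (G x)) mG)).
Qed.

End transport.

Section heisenberg_kernel.
Context {R : realType}.
Local Notation mR := (measurableTypeR R).

Lemma dot0 (p q : 0.-tuple R) : dot p q = 0.
Proof. by rewrite /dot big_ord0. Qed.

Lemma dot_cons n (p q : n.+1.-tuple R) :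
  dot p q = thead p * thead q + dot [tuple of behead p] [tuple of behead q].
Proof.
rewrite /dot big_ord_recl; congr (_ + _); apply: eq_bigr => i _.
by rewrite !tnth_behead (_ : inord i.+1 = lift ord0 i)//; apply/val_inj; rewrite /= inordK// ltnS ltn_ord.
Qed.

Lemma summability_kernel_tuple n : exists K W,
  summability_kernel (@lebesgue_tuple R n) (fun p q => 2 * pi * dot p q) K W.
Proof.
elim: n => [|n [K [W sk]]].
  (* [R^0] is a point of mass 1 with zero phase, so the constant multiplier 1 has kernel 1. *)
  exists 1, (fun _ _ => 1).
  have phi0 (p q : 0.-tuple mR) : 2 * pi * dot p q = 0 :> R by rewrite dot0 mulr0.
  split.
  - by under eq_fun do rewrite phi0; exact: measurable_cst.
  - exact: ler01.
  - by move=> *; exact: ler01.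
  - move=> k; apply/integrableP; split; first exact: measurable_cst.
    by rewrite integral_dirac//= diracT mul1e normr1 ltry.
  - by move=> x; exact: cvg_cst.
  - move=> k x y; apply: integral0_eq => xi _.
    by rewrite !phi0 subrr sin0 mulr0.
  - move=> k x.
    have dE y : dirichlet (@lebesgue_tuple R 0) (fun p q => 2 * pi * dot p q)
        (fun=> 1) x y = 1%E.
      rewrite /dirichlet; under eq_integral do rewrite !phi0 subrr cos0 mulr1.
      by rewrite integral_cst//= diracT mule1.
    under eq_integral do rewrite dE.
    by rewrite integral_cst//= diracT mule1 normr1.
have sk1 := summability_kernel_prod (@summability_kernel_line R) sk.
eexists; eexists.
apply: (@summability_kernel_transport _ _ _ _ _
   (sigma_finite_prod (@lebesgue_measure R) (lebesgue_tuple n))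
   (@lebesgue_tuple R n.+1) (fun p => [tuple of p.1 :: p.2])
   (fun t => (thead t, [tuple of behead t])) _ _ _ _ _ _ _ _ _ sk1).
- exact: measurable_cons.
- apply: measurable_fun_pair; first exact: (measurable_tnth ord0).
  exact: measurable_behead.
- by move=> [x t]; congr pair; exact/val_inj.
- by [].
- by move=> p q; rewrite /= dot_cons mulrDr.
Qed.

Lemma summability_kernel_haar n : exists K W,
  summability_kernel (haar R n) (fun X Y => 2 * pi * inner X Y) K W.
Proof.
have [K [W sk]] := summability_kernel_tuple n.
have sk3 := summability_kernel_prod (summability_kernel_prod sk sk)
  (@summability_kernel_line R).
eexists; eexists.
apply: (@summability_kernel_transport _ _ _ _ _
   (sigma_finite_prod (sigma_finite_prod (lebesgue_tuple n) (lebesgue_tuple n))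
     (@lebesgue_measure R))
   (haar R n) idfun idfun _ _ _ _ _ _ _ _ _ sk3) => //; try exact: measurable_id.
by move=> [[p q] t] [[p' q'] t'] /=; rewrite !mulrDr.
Qed.

End heisenberg_kernel.

(** * Bessel's inequality *)

Section bessel.
Local Open Scope ereal_scope.
Context d (T : measurableType d) (R : realType).
Variables (mu : {sigma_finite_measure set T -> \bar R}) (phi : T -> T -> R).
Variables (K : R) (W : nat -> T -> R).
Hypothesis sk : summability_kernel mu phi K W.
Variable u : T -> R.
Hypothesis ui : mu.-integrable setT (EFin \o u).

(** For real [u], the Fourier transform with phase [phi] is [cos_transform - i sin_transform]. *)
Definition cos_transform (xi : T) : R := \int[mu]_x (u x * cos (phi xi x))%R.
Definition sin_transform (xi : T) : R := \int[mu]_x (u x * sin (phi xi x))%R.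

Let mu_u : measurable_fun setT u.
Proof. by apply/measurable_EFinP; exact: measurable_int ui. Qed.

Let mphi2 xi : measurable_fun setT (phi xi).
Proof.
exact: (measurableT_comp (sk_phi sk) (g := fun x => (xi, x)) (pair1_measurable xi)).
Qed.

Let mphi1 x : measurable_fun setT (phi ^~ x).
Proof. exact: (measurable_phi1 _ (sk_phi sk)). Qed.

Let integrable_cos xi : mu.-integrable setT (fun x => (u x * cos (phi xi x))%:E).
Proof.
apply: integrable_mul_bounded => //; last by move=> x; exact: cos_le1_norm.
by apply: measurableT_comp => //; exact: measurable_cos.
Qed.

Let integrable_sin xi : mu.-integrable setT (fun x => (u x * sin (phi xi x))%:E).
Proof.
apply: integrable_mul_bounded => //; last by move=> x; exact: sin_le1_norm.
by apply: measurableT_comp => //; exact: measurable_sin.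
Qed.

Let measurable_transform (h : R -> R) : measurable_fun setT h ->
  measurable_fun setT (fun xi => \int[mu]_x (u x * h (phi xi x))%R)%R.
Proof.
move=> mh; apply: measurableT_comp => //.
apply: (@measurable_fun_integral2 _ _ _ _ _ mu
  (fun z : T * T => (u z.2 * h (phi z.1 z.2))%:E)).
apply/measurable_EFinP/measurable_funM.
  exact: (measurableT_comp mu_u measurable_snd).
exact: (measurableT_comp mh (sk_phi sk)).
Qed.

Lemma measurable_cos_transform : measurable_fun setT cos_transform.
Proof. by apply: measurable_transform; exact: measurable_cos. Qed.

Lemma measurable_sin_transform : measurable_fun setT sin_transform.
Proof. by apply: measurable_transform; exact: measurable_sin. Qed.

Let N := (\int[mu]_x `|u x|)%R.

Let transform_le (h : R -> R) xi : measurable_fun setT h ->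
  (forall x, `|h x| <= 1)%R -> (`|\int[mu]_x (u x * h (phi xi x))%R| <= N)%R.
Proof.
move=> mh h1.
have uhi : mu.-integrable setT (fun x => (u x * h (phi xi x))%:E).
  by apply: integrable_mul_bounded => //; exact: measurableT_comp.
apply: (le_trans (le_normr_Rintegral _ _)) => //.
apply: le_Rintegral => //.
- exact: integrable_norm.
- exact: integrable_norm.
- by move=> x _; rewrite normrM ler_piMr.
Qed.

Lemma cos_transform_le xi : (`|cos_transform xi| <= N)%R.
Proof. by apply: transform_le; [exact: measurable_cos|exact: cos_le1_norm]. Qed.

Lemma sin_transform_le xi : (`|sin_transform xi| <= N)%R.
Proof. by apply: transform_le; [exact: measurable_sin|exact: sin_le1_norm]. Qed.

Let c := cos_transform.
Let s := sin_transform.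

(** Real part of [(c - i s)(xi) e^(i phi xi x)], the integrand of Fourier inversion. Integrated
    against [u] in [x], it gives [c ^+ 2 + s ^+ 2]. *)
Let h (xi x : T) := (c xi * cos (phi xi x) + s xi * sin (phi xi x))%R.

Let mh : measurable_fun setT (fun z : T * T => h z.1 z.2).
Proof.
apply: measurable_funD; apply: measurable_funM.
- exact: (measurableT_comp measurable_cos_transform measurable_fst).
- by apply: measurableT_comp; [exact: measurable_cos|exact: (sk_phi sk)].
- exact: (measurableT_comp measurable_sin_transform measurable_fst).
- by apply: measurableT_comp; [exact: measurable_sin|exact: (sk_phi sk)].
Qed.

Let h_le xi x : (`|h xi x| <= 2 * N)%R.
Proof.
rewrite (le_trans (ler_normD _ _))// mulr_natl mulr2n lerD// normrM.
  by rewrite -[leRHS]mulr1 ler_pM// ?cos_transform_le ?cos_le1_norm.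
by rewrite -[leRHS]mulr1 ler_pM// ?sin_transform_le ?sin_le1_norm.
Qed.

(** Fourier inversion truncated by [W k]; [DE] identifies it with the kernel [dirichlet] applied to
    [u]. *)
Let D k x := \int[mu]_xi (W k xi * h xi x)%:E.

Let hE xi x : (h xi x)%:E = \int[mu]_y (u y * cos (phi xi x - phi xi y))%:E.
Proof.
rewrite /h.
have eC : \int[mu]_y (u y * cos (phi xi y))%:E = (c xi)%:E.
  by rewrite fineK//; exact: integrable_fin_num.
have eS : \int[mu]_y (u y * sin (phi xi y))%:E = (s xi)%:E.
  by rewrite fineK//; exact: integrable_fin_num.
transitivity (\int[mu]_y ((cos (phi xi x))%:E * (u y * cos (phi xi y))%:E +
    (sin (phi xi x))%:E * (u y * sin (phi xi y))%:E)); last first.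
  apply: eq_integral => y _; rewrite -!EFinM -EFinD; congr EFin.
  by rewrite cosB; ring.
rewrite integralD//; [|exact: integrableZl|exact: integrableZl].
by rewrite !integralZl// eC eS -!EFinM -EFinD; congr EFin; ring.
Qed.

Let N2_ge0 : (0 <= 2 * N)%R.
Proof. by rewrite mulr_ge0//; exact: Rintegral_ge0. Qed.

(** The integrable function [W k xi * u x], times [C], dominates the integrand. The multiplier
    supplies the integrability in [xi], which the transform alone has no reason to have. *)
Let fubini_aux (g : T * T -> R) (C : R) k : measurable_fun setT g ->
  (0 <= C)%R -> (forall z, `|g z| <= C)%R ->
  \int[mu]_xi \int[mu]_x (W k xi * u x * g (xi, x))%:E =
  \int[mu]_x \int[mu]_xi (W k xi * u x * g (xi, x))%:E.
Proof.
move=> mg C0 gC; apply: (@Fubini _ _ _ _ _ mu mu (fun z => (W k z.1 * u z.2 * g z)%:E)).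
have wu := integrable_prod (sk_int sk k) ui.
apply: (le_integrable measurableT _ _ (integrableZl _ C wu)) => //.
  apply/measurable_EFinP/measurable_funM => //.
  by apply/measurable_EFinP; exact: measurable_int wu.
move=> z _; rewrite -EFinM lee_fin mulrC !normrM (ger0_norm C0).
by apply: ler_wpM2r => //; rewrite mulr_ge0.
Qed.

Let DE k x : D k x = \int[mu]_y ((u y)%:E * dirichlet mu phi (W k) x y).
Proof.
rewrite /D.
have mg : measurable_fun setT (fun z : T * T => cos (phi z.1 x - phi z.1 z.2)).
  apply: measurableT_comp; first exact: measurable_cos.
  apply: measurable_funB; last exact: (sk_phi sk).
  exact: (measurableT_comp (mphi1 x) measurable_fst).
transitivity (\int[mu]_xi \int[mu]_y (W k xi * u y * cos (phi xi x - phi xi y))%:E).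
  apply: eq_integral => xi _; rewrite EFinM hE -integralZl//.
    by apply: eq_integral => y _; rewrite -EFinM mulrA.
  apply: integrable_mul_bounded => // [|y]; last exact: cos_le1_norm.
  apply: measurableT_comp; first exact: measurable_cos.
  by apply: measurable_funB.
have /= -> := fubini_aux k mg ler01 (fun z => cos_le1_norm _).
apply: eq_integral => y _; rewrite /dirichlet -integralZl//; last exact: integrable_sk_cos sk k x y.
by apply: eq_integral => xi _; rewrite -EFinM; congr EFin; ring.
Qed.

Let weighted_energyE k : \int[mu]_xi (W k xi * (c xi ^+ 2 + s xi ^+ 2))%:E =
  \int[mu]_x ((u x)%:E * D k x).
Proof.
transitivity (\int[mu]_xi \int[mu]_x (W k xi * u x * h xi x)%:E).
  apply: eq_integral => xi _.
  have eC : \int[mu]_y (u y * cos (phi xi y))%:E = (c xi)%:E.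
    by rewrite fineK//; exact: integrable_fin_num.
  have eS : \int[mu]_y (u y * sin (phi xi y))%:E = (s xi)%:E.
    by rewrite fineK//; exact: integrable_fin_num.
  transitivity (\int[mu]_y ((W k xi * c xi)%:E * (u y * cos (phi xi y))%:E +
    (W k xi * s xi)%:E * (u y * sin (phi xi y))%:E)); last first.
    apply: eq_integral => y _; rewrite -!EFinM -EFinD; congr EFin.
    by rewrite /h; ring.
  rewrite integralD//; [|exact: integrableZl|exact: integrableZl].
  by rewrite !integralZl// eC eS -!EFinM -EFinD; congr EFin; ring.
have /= -> := fubini_aux k mh N2_ge0 (fun z => h_le z.1 z.2).
apply: eq_integral => x _.
rewrite /D -integralZl//.
  by apply: eq_integral => xi _; rewrite -EFinM; congr EFin; ring.
apply: (le_integrable measurableT _ _ (integrableZl _ (2 * N) (sk_int sk k))) => //.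
  apply/measurable_EFinP/measurable_funM; first exact: (sk_measurable sk).
  exact: (measurableT_comp mh (g := fun xi => (xi, x)) (pair2_measurable x)).
move=> xi _; rewrite -EFinM lee_fin mulrC !normrM.
by apply: ler_wpM2r => //; rewrite (le_trans (h_le _ _))// -normrM ler_norm.
Qed.

(** Schur's test: [|u x * u y| <= (u x ^+ 2 + u y ^+ 2) / 2] splits the double integral into halves
    [A] and [B], with the same integral because the kernel is symmetric. In [A] the kernel is
    integrated alone in [y], which costs at most [K]. *)
Let weighted_energy_le k :
  \int[mu]_xi (W k xi * (c xi ^+ 2 + s xi ^+ 2))%:E <= K%:E * \int[mu]_x (u x ^+ 2)%:E.
Proof.
pose dl x y := `|dirichlet mu phi (W k) x y|.
have md : measurable_fun setT (fun z : T * T => dl z.1 z.2).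
  by apply: measurableT_comp => //; exact: measurable_dirichlet sk k.
have md1 x : measurable_fun setT (dl x).
  exact: (measurableT_comp md (g := fun y => (x, y)) (pair1_measurable x)).
have dC x y : dl x y = dl y x by rewrite /dl dirichletC.
have d0 x y : 0 <= dl x y by exact: abse_ge0.
have mu2 : measurable_fun setT (fun x => (u x ^+ 2)%:E).
  by apply/measurable_EFinP; exact: measurable_funX.
have mD : measurable_fun setT (D k).
  rewrite (_ : D k =
    (fun x => \int[mu]_y ((u y)%:E * dirichlet mu phi (W k) x y))); last first.
    by apply/funext => x; exact: DE.
  apply: (@measurable_fun_integral2 _ _ _ _ _ mu
    (fun z : T * T => (u z.2)%:E * dirichlet mu phi (W k) z.1 z.2)).
  apply: emeasurable_funM; last exact: measurable_dirichlet sk k.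
  by apply/measurable_EFinP; exact: (measurableT_comp mu_u measurable_snd).
have muD : measurable_fun setT (fun x => (u x)%:E * D k x).
  by apply: emeasurable_funM; first exact/measurable_EFinP.
have u20 x : 0 <= (u x ^+ 2)%:E by rewrite lee_fin sqr_ge0.
pose A z := (u z.1 ^+ 2)%:E * dl z.1 z.2.
pose B z := (u z.2 ^+ 2)%:E * dl z.1 z.2.
have mA : measurable_fun setT A.
  by apply: emeasurable_funM => //; exact: (measurableT_comp mu2 measurable_fst).
have mB : measurable_fun setT B.
  by apply: emeasurable_funM => //; exact: (measurableT_comp mu2 measurable_snd).
have A0 z : 0 <= A z by rewrite mule_ge0.
have B0 z : 0 <= B z by rewrite mule_ge0.
rewrite weighted_energyE.
apply: (@le_trans _ _ (\int[mu]_x \int[mu]_y (2^-1%:E * (A (x, y) + B (x, y))))).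
  apply: (le_trans (lee_abs _)).
  apply: (le_trans (le_abse_integral _ _ _)) => //.
  apply: ge0_le_integral => //.
  - exact: measurableT_comp.
  - apply: (@measurable_fun_integral2 _ _ _ _ _ mu (fun z => 2^-1%:E * (A z + B z))).
    by apply: emeasurable_funM; [exact: measurable_cst|exact: emeasurable_funD].
  - move=> x _; rewrite abseM DE.
    apply: (@le_trans _ _ (`|(u x)%:E| * \int[mu]_y (`|(u y)%:E| * dl x y))).
      apply: lee_wpmul2l => //.
      apply: (le_trans (le_abse_integral _ _ _)) => //.
        apply: emeasurable_funM; first exact/measurable_EFinP.
        exact: (measurableT_comp (measurable_dirichlet sk k) (g := fun y => (x, y))
          (pair1_measurable x)).
      by under eq_integral do rewrite abseM.
    rewrite -ge0_integralZl//; last 2 first.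
    + apply: emeasurable_funM => //.
      by apply: measurableT_comp => //; exact/measurable_EFinP.
    + by move=> y _; rewrite mule_ge0.
    apply: ge0_le_integral.
    + by [].
    + by move=> y _; apply: mule_ge0 => //; exact: mule_ge0.
    + apply: emeasurable_funM; first exact: measurable_cst.
      apply: emeasurable_funM => //.
      by apply: measurableT_comp => //; exact/measurable_EFinP.
    + apply: emeasurable_funM; first exact: measurable_cst.
      apply: emeasurable_funD.
        exact: (measurableT_comp mA (pair1_measurable x)).
      exact: (measurableT_comp mB (pair1_measurable x)).
    + move=> y _; rewrite /A /B/= -ge0_muleDl// muleA muleA.
      apply: lee_wpmul2r => //; rewrite -EFinD -!EFinM lee_fin.
      have := sqr_ge0 (`|u x| - `|u y|)%R.
      by rewrite -[(u x ^+ 2)%R]real_normK ?num_real// -[(u y ^+ 2)%R]real_normK ?num_real//; nra.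
pose I := \int[mu]_x (u x ^+ 2)%:E.
have iA : measurable_fun setT (fun x => \int[mu]_y A (x, y)).
  exact: measurable_fun_integral2.
have iB : measurable_fun setT (fun x => \int[mu]_y B (x, y)).
  exact: measurable_fun_integral2.
have iA0 x : 0 <= \int[mu]_y A (x, y) by exact: integral_ge0.
have iB0 x : 0 <= \int[mu]_y B (x, y) by exact: integral_ge0.
have mAx x : measurable_fun setT (fun y => A (x, y)).
  exact: (measurableT_comp mA (pair1_measurable x)).
have mBx x : measurable_fun setT (fun y => B (x, y)).
  exact: (measurableT_comp mB (pair1_measurable x)).
have iAB x : \int[mu]_y (2^-1%:E * (A (x, y) + B (x, y))) =
    2^-1%:E * (\int[mu]_y A (x, y) + \int[mu]_y B (x, y)).
  rewrite ge0_integralZl//; last 2 first.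
  - exact: (emeasurable_funD (mAx x) (mBx x)).
  - by move=> y _; rewrite adde_ge0.
  congr (_ * _); exact: (ge0_integralD mu measurableT
    (fun y _ => A0 (x, y)) (mAx x) (fun y _ => B0 (x, y)) (mBx x)).
under eq_integral do rewrite iAB.
rewrite ge0_integralZl//; last 2 first.
- exact: (emeasurable_funD iA iB).
- by move=> x _; rewrite adde_ge0.
have -> := ge0_integralD mu measurableT (fun x _ => iA0 x) iA (fun x _ => iB0 x) iB.
have mdI : measurable_fun setT (fun x => \int[mu]_y dl x y).
  exact: (@measurable_fun_integral2 _ _ _ _ _ mu (fun z : T * T => dl z.1 z.2)).
have IA : \int[mu]_x \int[mu]_y A (x, y) <= K%:E * \int[mu]_x (u x ^+ 2)%:E.
  rewrite (eq_integral (fun x => (u x ^+ 2)%:E * \int[mu]_y dl x y)); last first.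
    by move=> x _; rewrite /A/= ge0_integralZl.
  rewrite muleC -ge0_integralZr//; last first.
    by rewrite lee_fin (sk_bound_ge0 sk).
  apply: ge0_le_integral => //.
  - by move=> x _; rewrite mule_ge0//; exact: integral_ge0.
  - exact: emeasurable_funM.
  - by apply: emeasurable_funM => //; exact: measurable_cst.
  - by move=> x _; apply: lee_wpmul2l => //; exact: (sk_cos sk).
have IB : \int[mu]_x \int[mu]_y B (x, y) <= K%:E * \int[mu]_x (u x ^+ 2)%:E.
  have -> := @fubini_tonelli _ _ _ _ _ mu mu B mB B0.
  apply: le_trans IA; rewrite le_eqVlt; apply/orP; left; apply/eqP.
  by apply: eq_integral => x _; apply: eq_integral => y _; rewrite /A /B/= dC.
apply: (@le_trans _ _ (2^-1%:E * (K%:E * I + K%:E * I))).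
  by apply: lee_wpmul2l; [rewrite lee_fin invr_ge0|exact: (leeD IA IB)].
rewrite -ge0_muleDl ?lee_fin ?(sk_bound_ge0 sk)// muleA -EFinD -EFinM.
by rewrite (_ : (2^-1 * (K + K))%R = K)//; field.
Qed.

Theorem cos_sin_transform_bessel :
  \int[mu]_xi (c xi ^+ 2 + s xi ^+ 2)%:E <= K%:E * \int[mu]_x (u x ^+ 2)%:E.
Proof.
pose f k xi := (W k xi * (c xi ^+ 2 + s xi ^+ 2))%:E.
have mf k : measurable_fun setT (f k).
  apply/measurable_EFinP; apply: measurable_funM; first exact: (sk_measurable sk).
  by apply: measurable_funD; apply: measurable_funX;
    [exact: measurable_cos_transform|exact: measurable_sin_transform].
have f0 k xi : 0 <= f k xi.
  by rewrite lee_fin mulr_ge0 ?(sk_ge0 sk)// addr_ge0// sqr_ge0.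
rewrite (eq_integral (fun xi => limn_einf (f ^~ xi))); last first.
  move=> xi _; rewrite (@cvg_limn_einf_sup _ _ (c xi ^+ 2 + s xi ^+ 2)%:E)//.
  apply: cvg_EFin; first exact: nearW.
  rewrite -[X in _ --> X]mul1r; apply: cvgM; last exact: cvg_cst.
  exact: (sk_cvg sk).
apply: (le_trans (fatou _ measurableT mf _)) => //.
rewrite limn_einf_lim; apply: lime_le; first exact: is_cvg_einfs.
apply: nearW => k; apply: le_trans (weighted_energy_le k).
by apply: ereal_inf_lbound; exists k => /=.
Qed.

End bessel.

(** * Translations and balls of the Heisenberg group *)

Section measurability.
Context {R : realType}.
Local Notation mR := (measurableTypeR R).
Context d (T : measurableType d).

Lemma measurable_dot n (f g : T -> n.-tuple mR) :
  measurable_fun setT f -> measurable_fun setT g ->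
  measurable_fun setT (fun x => dot (f x) (g x)).
Proof.
move=> mf mg; apply: measurable_sum => i.
apply: measurable_funM.
  exact: (measurableT_comp (measurable_tnth i) mf).
exact: (measurableT_comp (measurable_tnth i) mg).
Qed.

Lemma measurable_addt n (f g : T -> n.-tuple mR) :
  measurable_fun setT f -> measurable_fun setT g ->
  measurable_fun setT (fun x => (addt (f x) (g x) : n.-tuple mR)).
Proof.
move=> mf mg; apply/measurable_fun_tnthP => i.
rewrite (_ : _ \o _ = fun x => tnth (f x) i + tnth (g x) i); last first.
  by apply/funext => x /=; rewrite tnth_mktuple.
apply: measurable_funD.
  exact: (measurableT_comp (measurable_tnth i) mf).
exact: (measurableT_comp (measurable_tnth i) mg).
Qed.

End measurability.

Section right_translation.
Context {R : realType}.
Local Notation mR := (measurableTypeR R).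
Local Open Scope ereal_scope.

(** Induction with Tonelli: the head is shifted on the line, the tail by the induction
    hypothesis. *)
Lemma ge0_integral_addt n (a : n.-tuple mR) (f : n.-tuple mR -> \bar R) :
  measurable_fun setT f -> (forall p, 0 <= f p) ->
  \int[lebesgue_tuple n]_p f (addt p a) = \int[lebesgue_tuple n]_p f p.
Proof.
elim: n a f => [|n IH] a f mf f0.
  by apply: eq_integral => p _; rewrite (tuple0 p) (tuple0 (addt _ _)).
have maddt : measurable_fun setT (fun p : n.+1.-tuple mR => f (addt p a)).
  by apply: (measurableT_comp mf); apply: measurable_addt;
    [exact: measurable_id|exact: measurable_cst].
pose c (z : mR * n.-tuple mR) : n.+1.-tuple mR := [tuple of z.1 :: z.2].
have mc : measurable_fun setT c by exact: measurable_cons.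
have tr g : measurable_fun setT g -> (forall p, 0 <= g p) ->
    \int[lebesgue_tuple n.+1]_p g p =
    \int[lebesgue_measure]_x \int[lebesgue_tuple n]_p g (c (x, p)).
  move=> mg g0; rewrite (@integral_transport _ _ _ _ _
    (sigma_finite_prod (@lebesgue_measure R) (lebesgue_tuple n))
    (@lebesgue_tuple R n.+1) c mc _ _ mg)//.
  rewrite (@fubini_tonelli1 _ _ _ _ _ (@lebesgue_measure R) (lebesgue_tuple n) (g \o c))//=.
    exact: measurableT_comp mg mc.
rewrite (tr _ maddt (fun p => f0 _)) (tr _ mf f0).
pose F (x : mR) := \int[lebesgue_tuple n]_p f (c (x, p)).
have mF : measurable_fun setT F.
  by apply: (measurable_fun_integral2 _ (measurableT_comp mf mc)).
rewrite -(@ge0_integral_shift R (thead a) F mF); last first.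
  by move=> x; exact: integral_ge0.
apply: eq_integral => x _; rewrite /F.
rewrite -(IH [tuple of behead a] (fun p => f (c ((x + thead a)%R, p))))//; last first.
  exact: (measurableT_comp (measurableT_comp mf mc) (pair1_measurable _)).
apply: eq_integral => p _; congr f; apply/eq_from_tnth => i.
rewrite tnth_mktuple.
have [j ->|->] := unliftP ord0 i.
  by rewrite /c !tnthS tnth_mktuple tnth_behead; congr (_ + tnth a _)%R;
     apply/val_inj; rewrite /= inordK// ltnS ltn_ord.
by rewrite /c !tnth0.
Qed.

Lemma measurable_hmul n (P : heisenberg R n) :
  measurable_fun setT (fun X : heisenberg R n => (hmul X P : heisenberg R n)).
Proof.
case: P => [[p' q'] t'].
have mp : measurable_fun setT (fun X : heisenberg R n => X.1.1).
  exact: measurableT_comp.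
have mq : measurable_fun setT (fun X : heisenberg R n => X.1.2).
  exact: measurableT_comp.
rewrite (_ : (fun X => _) = fun X : heisenberg R n =>
  (addt X.1.1 p', addt X.1.2 q', (X.2 + t' + (dot X.1.1 q' - dot X.1.2 p') / 2)%R)); last first.
  by apply/funext => -[[p q] t].
apply: measurable_fun_pair; first apply: measurable_fun_pair.
- by apply: measurable_addt => //; exact: measurable_cst.
- by apply: measurable_addt => //; exact: measurable_cst.
- apply: measurable_funD.
    by apply: measurable_funD; [exact: measurable_snd|exact: measurable_cst].
  apply: measurable_funM; last exact: measurable_cst.
  by apply: measurable_funB; apply: measurable_dot => //; exact: measurable_cst.
Qed.

(* Fubini: a translation in t depending on (p, q), followed by one in (p, q). *)
Lemma ge0_integral_hmul n (P : heisenberg R n) (f : heisenberg R n -> \bar R) :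
  measurable_fun setT f -> (forall X, 0 <= f X) ->
  \int[haar R n]_X f (hmul X P) = \int[haar R n]_X f X.
Proof.
case: P => [[p' q'] t'] mf f0.
pose m := lebesgue_tuple (R := R) n; pose l := @lebesgue_measure R.
have tr g : measurable_fun setT g -> (forall X, 0 <= g X) ->
    \int[haar R n]_X g X = \int[m]_p \int[m]_q \int[l]_t g (p, q, t).
  move=> mg g0.
  transitivity (\int[sigma_finite_prod m m]_z \int[l]_t g (z, t)).
    exact: (@fubini_tonelli1 _ _ _ _ _ (sigma_finite_prod m m) l g mg g0).
  apply: (@fubini_tonelli1 _ _ _ _ _ m m (fun z => \int[l]_t g (z, t))).
    exact: measurable_fun_integral2.
  by move=> z; exact: integral_ge0.
rewrite (tr _ (measurableT_comp mf (measurable_hmul _)) (fun X => f0 _)) (tr _ mf f0).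
pose G p q := \int[l]_t f (p, q, t).
have mG : measurable_fun setT (fun z : n.-tuple mR * n.-tuple mR => G z.1 z.2).
  rewrite (_ : (fun z => _) = (fun z => \int[l]_t f (z, t))).
    exact: measurable_fun_integral2.
  by apply/funext => -[].
have G0 p q : 0 <= G p q by exact: integral_ge0.
transitivity (\int[m]_p \int[m]_q G (addt p p') (addt q q')).
  apply: eq_integral => p _; apply: eq_integral => q _.
  rewrite /G -(@ge0_integral_shift R (t' + (dot p q' - dot q p') / 2)%R
    (fun t => f (addt p p', addt q q', t))).
  - by apply: eq_integral => t _; rewrite /= addrA.
  - exact: (measurableT_comp mf (pair1_measurable _)).
  - by move=> t; exact: f0.
transitivity (\int[m]_p \int[m]_q G (addt p p') q).
  apply: eq_integral => p _.
  rewrite (ge0_integral_addt _ (f := G (addt p p')))//.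
  exact: (measurableT_comp mG (pair1_measurable _)).
rewrite (ge0_integral_addt _ (f := fun p => \int[m]_q G p q))//.
  exact: (measurable_fun_integral2 _ mG).
by move=> p; exact: integral_ge0.
Qed.

End right_translation.

Section koranyi_balls.
Context {R : realType}.
Local Notation mR := (measurableTypeR R).

Lemma dot_ge0 n (p : n.-tuple R) : 0 <= dot p p.
Proof. by apply: sumr_ge0 => i _; rewrite -expr2 sqr_ge0. Qed.

Lemma koranyi_ge0 n (X : heisenberg R n) : 0 <= koranyi X.
Proof. by case: X => [[p q] t]; exact: powR_ge0. Qed.

Lemma measurable_koranyi n : measurable_fun setT (@koranyi R n).
Proof.
rewrite (_ : @koranyi R n = fun X : heisenberg R n =>
  ((dot X.1.1 X.1.1 + dot X.1.2 X.1.2) ^+ 2 + X.2 ^+ 2) `^ (1 / 4)); last first.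
  by apply/funext => -[[p q] t].
have mp : measurable_fun setT (fun X : heisenberg R n => X.1.1).
  exact: measurableT_comp.
have mq : measurable_fun setT (fun X : heisenberg R n => X.1.2).
  exact: measurableT_comp.
apply: (measurableT_comp (measurable_powR _)).
apply: measurable_funD; apply: measurable_funX; last exact: measurable_snd.
by apply: measurable_funD; exact: measurable_dot.
Qed.

(** A Euclidean ball; the name recalls that its volume is bounded by that of the cube of side
    [2 r]. *)
Let box n (r : R) : set (n.-tuple mR) := [set p | dot p p <= r ^+ 2].

Let measurable_box n r : measurable (@box n r).
Proof.
have := measurable_dot (@measurable_id _ (n.-tuple mR) setT) (@measurable_id _ _ setT).
move=> /(_ measurableT) /(_ `]-oo, (r ^+ 2)]%classic) /(_ (measurable_itv _)).
by rewrite setTI; congr measurable; apply/seteqP; split => p/=; rewrite /box/= in_itv.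
Qed.

Let lebesgue_tuple_box n (r : R) : 0 < r ->
  (lebesgue_tuple n (@box n r) <= ((2 * r) ^+ n)%:E)%E.
Proof.
move=> r0; elim: n => [|n IH].
  by rewrite /= diracE expr0 lee_fin; case: (_ \in _).
rewrite /= /lebesgue_cons /pushforward.
apply: (@le_trans _ _ ((lebesgue_measure \x lebesgue_tuple n)%E
  (`[(- r)%R, r]%classic `*` @box n r))).
  apply: le_measure; rewrite ?inE.
  - rewrite -[X in measurable X]setTI.
    have mc : measurable_fun setT
        (fun z : mR * n.-tuple mR => [tuple of z.1 :: z.2] : n.+1.-tuple mR).
      exact: measurable_cons.
    by apply: mc => //; exact: measurable_box.
  - by apply: measurableX => //; exact: measurable_box.
  - move=> [x p]/=; rewrite /box/= dot_cons/= => h.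
    have {}h : x * x + dot p p <= r ^+ 2.
      move: h; rewrite (_ : [tuple of behead [tuple of x :: p]] = p :> n.-tuple R)//.
      exact/val_inj.
    split.
      rewrite in_itv/= -ler_norml -(ger0_norm (ltW r0)) -ler_sqr ?nnegrE//.
      rewrite !real_normK ?num_real// (le_trans _ h)// -expr2 lerDl.
      exact: dot_ge0.
    by rewrite (le_trans _ h)//= lerDr -expr2 sqr_ge0.
rewrite product_measure1E//; last exact: measurable_box.
rewrite [X in (X * _)%E]lebesgue_measure_itv/= lte_fin ifT; last lra.
rewrite exprS EFinM -EFinD; apply: lee_pmul => //.
  by rewrite lee_fin; lra.
by rewrite lee_fin; lra.
Qed.

(** The ball lies in [|p| <= r], [|q| <= r], [|t| <= r ^ 2]. The last coordinate contributes
    [2 r ^ 2], which raises the exponent from the dimension [2 n + 1] to [2 n + 2]. *)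
Lemma haar_koranyi_ball n (r : R) : 0 < r ->
  (haar R n [set X | koranyi X <= r]%R <= (2 ^+ (2 * n + 1) * r ^+ (homogeneous_dim n))%:E)%E.
Proof.
move=> r0.
apply: (@le_trans _ _ (haar R n ((@box n r `*` @box n r) `*`
   `[(- r ^+ 2)%R, (r ^+ 2)%R]%classic))).
  apply: le_measure; rewrite ?inE.
  - have := @measurable_koranyi n measurableT _ (measurable_itv `]-oo, r]).
    by rewrite setTI; congr measurable; apply/seteqP; split => p/=; rewrite in_itv.
  - apply: measurableX; last exact: measurable_itv.
    by apply: measurableX; exact: measurable_box.
  - move=> [[p q] t]/=; rewrite /box/= => h.
    have {}h : (dot p p + dot q q) ^+ 2 + t ^+ 2 <= (r ^+ 2) ^+ 2.
      have S0 : 0 <= (dot p p + dot q q) ^+ 2 + t ^+ 2.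
        by rewrite addr_ge0 ?sqr_ge0.
      have := @ge0_ler_powR R 4%:R (ler0n _ _) _ _ _ _ h.
      rewrite !nnegrE powR_ge0 (ltW r0) => /(_ isT isT).
      rewrite -powRrM mulrC mul1r divff ?pnatr_eq0// powRr1// (powR_mulrn _ (ltW r0)).
      by rewrite -exprM.
    have p0 := dot_ge0 p; have q0 := dot_ge0 q.
    have r20 : 0 <= r ^+ 2 by rewrite sqr_ge0.
    have pq : dot p p + dot q q <= r ^+ 2.
      rewrite -ler_sqr ?nnegrE ?addr_ge0//.
      by apply: le_trans h; rewrite lerDl sqr_ge0.
    split; first by split; apply: le_trans pq; rewrite ?lerDl ?lerDr.
    rewrite in_itv/= -ler_norml -(ger0_norm r20) -ler_sqr ?nnegrE//.
    rewrite ![`|_| ^+ 2]real_normK ?num_real//.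
    by apply: le_trans h; rewrite lerDr sqr_ge0.
have -> : haar R n ((@box n r `*` @box n r) `*` `[(- r ^+ 2)%R, (r ^+ 2)%R]%classic) =
   (lebesgue_tuple n (@box n r) * lebesgue_tuple n (@box n r) * (2 * r ^+ 2)%:E)%E.
  rewrite /haar [LHS]product_measure1E//; last first.
    by apply: measurableX; exact: measurable_box.
  rewrite [X in (X * _)%E]product_measure1E; [|exact: measurable_box|exact: measurable_box].
  congr (_ * _)%E.
  rewrite [LHS]lebesgue_measure_itv/= lte_fin ifT; last first.
    by have : 0 < r ^+ 2 by [rewrite exprn_gt0|]; lra.
  by rewrite -EFinD; congr EFin; lra.
rewrite (_ : 2 ^+ (2 * n + 1) * r ^+ homogeneous_dim n =
    (2 * r) ^+ n * (2 * r) ^+ n * (2 * r ^+ 2)); last first.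
  by rewrite /homogeneous_dim mul2n -addnn !exprMn !exprD expr1; ring.
rewrite !EFinM; apply: lee_pmul.
- by rewrite mule_ge0.
- by rewrite -EFinM lee_fin mulr_ge0// sqr_ge0.
- by apply: lee_pmul => //; exact: lebesgue_tuple_box.
- by rewrite -EFinM.
Qed.

End koranyi_balls.

(** * Integrals of powers of a norm *)

Section L2.
Local Open Scope ereal_scope.
Context d (T : measurableType d) (R : realType).
Variable mu : {measure set T -> \bar R}.

Lemma Lnorm2_sqr (f : T -> R) :
  Lnorm mu 2%:E (EFin \o f) ^+ 2 = \int[mu]_x (f x ^+ 2)%:E.
Proof.
rewrite expe2 unlock /= poweR12_sqrt; last first.
  by apply: integral_ge0 => x _; rewrite lee_fin powR_ge0.
rewrite -expe2 sqr_sqrte; last by apply: integral_ge0 => x _; rewrite lee_fin powR_ge0.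
apply: eq_integral => x _.
by rewrite powR_mulrn// real_normK// num_real.
Qed.

Lemma cauchy_schwarz (f g : T -> R) :
  measurable_fun setT f -> measurable_fun setT g ->
  (\int[mu]_x `|f x * g x|%:E) ^+ 2 <=
  (\int[mu]_x (f x ^+ 2)%:E) * (\int[mu]_x (g x ^+ 2)%:E).
Proof.
move=> mf mg.
have half : (2^-1 + 2^-1 = 1 :> R)%R by lra.
have := @hoelder _ T R mu f g 2 2 mf mg (ltr0n _ _) (ltr0n _ _) half.
rewrite Lnorm1 => h.
rewrite -!Lnorm2_sqr !expe2 muleACA -!expe2.
rewrite lee_sqr//; first exact: integral_ge0.
by rewrite mule_ge0// Lnorm_ge0.
Qed.

End L2.

Section weight.
Context d (T : measurableType d) (R : realType).
Variable mu : {measure set T -> \bar R}.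
Variables (N : T -> R) (c : R) (Q : nat) (b : R).
Hypothesis mN : measurable_fun setT N.
Hypothesis c0 : 0 <= c.
Hypothesis b0 : 0 < b.
Hypothesis bQ : b < Q%:R.
Hypothesis ball_le : forall r, 0 < r ->
  (mu [set x | N x <= r]%R <= (c * r ^+ Q)%:E)%E.

Let measurable_oc (x y : R) : measurable [set z | x < N z <= y].
Proof.
have := mN measurableT (measurable_itv `]x, y]).
by rewrite setTI; congr measurable; apply/seteqP; split => p/=; rewrite in_itv.
Qed.

Let measurable_ball (r : R) : measurable [set x | N x <= r].
Proof.
have := mN measurableT (measurable_itv `]-oo, r]).
by rewrite setTI; congr measurable; apply/seteqP; split => p/=; rewrite in_itv.
Qed.

Let w x := (N x `^ (- b))%:E.

Let mw A : measurable A -> measurable_fun A w.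
Proof.
move=> mA; apply: (measurable_funS measurableT) => //.
by apply/measurable_EFinP; exact: (measurableT_comp (measurable_powR _) mN).
Qed.

Let w0 x : (0 <= w x)%E. Proof. by rewrite lee_fin powR_ge0. Qed.

(** Ratio of the geometric series over dyadic shells: halving the radius multiplies [r ^ (Q - b)] by
    [q], and [b < Q] makes [q < 1]. *)
Let q : R := 2 `^ (- (Q%:R - b)).

Let q_lt1 : 0 < q < 1.
Proof.
rewrite powR_gt0//= /q powRN invf_lt1 ?powR_gt0//.
have Qb : 0 < Q%:R - b by rewrite subr_gt0.
have := @gt0_ltr_powR R _ Qb 1 2; rewrite !nnegrE powR1; apply => //.
by rewrite ltr1n.
Qed.

(** Sum of that series, whose outermost shell contributes [c * 2 ^ b]; equivalently the solution of
    [L * q + c * 2 ^ b = L]. *)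
Let L : R := c * 2 `^ b / (1 - q).

Let powR_half (r : R) : 0 < r -> (r / 2) `^ (Q%:R - b) = q * r `^ (Q%:R - b).
Proof.
by move=> r0; rewrite (powRM _ (ltW r0)) ?invr_ge0// -powR_inv1// -powRrM mulN1r mulrC.
Qed.

(** On the shell the weight is at most [(r / 2) ^ (- b)], and the shell is contained in the ball of
    radius [r]. *)
Let shell_le (r : R) : 0 < r ->
  (\int[mu]_(x in [set x | r / 2 < N x <= r]%R) w x <=
   (c * 2 `^ b * r `^ (Q%:R - b))%:E)%E.
Proof.
move=> r0; have r20 : 0 < r / 2 by rewrite divr_gt0.
apply: (@le_trans _ _ (\int[mu]_(x in [set x | r / 2 < N x <= r]%R) ((r / 2) `^ (- b))%:E)%E).
  apply: ge0_le_integral => //.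
  - exact: mw.
  - move=> x /= /andP[h1 h2]; rewrite lee_fin !powRN.
    rewrite lef_pV2 ?posrE ?powR_gt0// ?(lt_trans r20)//.
    by apply: ge0_ler_powR; rewrite ?nnegrE ?(ltW b0) ?(ltW r20) ?(ltW (lt_trans r20 h1)) ?(ltW h1).
rewrite integral_cst//.
apply: (@le_trans _ _ (((r / 2) `^ (- b))%:E * (c * r ^+ Q)%:E)%E).
  apply: lee_wpmul2l; first by rewrite lee_fin powR_ge0.
  apply: le_trans (ball_le r0); apply: le_measure; rewrite ?inE.
  - exact: measurable_oc.
  - exact: measurable_ball.
  - by move=> x /= /andP[].
rewrite -EFinM lee_fin (powRM _ (ltW r0)) ?invr_ge0// -(powR_mulrn _ (ltW r0)).
rewrite -powR_inv1// -powRrM mulN1r opprK.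
rewrite [Q%:R - b]addrC powRD; last by apply/implyP => _; rewrite gt_eqF.
by rewrite le_eqVlt; apply/orP; left; apply/eqP; ring.
Qed.

(** Induction on the number of shells: the outermost one is split off and the hypothesis is applied
    at radius [r / 2]. The equation solved by [L] makes the bound reproduce itself. *)
Let truncated_le m (r : R) : 0 < r ->
  (\int[mu]_(x in [set x | r / 2 ^+ m < N x <= r]%R) w x <=
   (L * r `^ (Q%:R - b))%:E)%E.
Proof.
have /andP[q0 q1] := q_lt1.
elim: m r => [|m IH] r r0.
  rewrite (_ : [set _ | _] = set0) ?integral_set0.
    by rewrite lee_fin !mulr_ge0 ?invr_ge0 ?powR_ge0// subr_ge0 ltW.
  rewrite -subset0 => x /=; rewrite expr0 divr1 => /andP[h1 h2].
  by move: (lt_le_trans h1 h2); rewrite ltxx.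
have r20 : 0 < r / 2 by rewrite divr_gt0.
have E : r / 2 ^+ m.+1 = r / 2 / 2 ^+ m by rewrite exprS invfM mulrA.
have m1 : r / 2 / 2 ^+ m <= r / 2.
  by rewrite ler_pdivrMr ?exprn_gt0// ler_peMr ?(ltW r20)// exprn_ege1// ler1n.
rewrite (_ : [set _ | _] = [set x | r / 2 / 2 ^+ m < N x <= r / 2] `|`
    [set x | r / 2 < N x <= r]); last first.
  apply/seteqP; split => x /=; rewrite E.
    move=> /andP[h1 h2]; have [h|h] := leP (N x) (r / 2).
      by left; rewrite h1.
    by right.
  move=> [/andP[-> h]|/andP[h ->]] /=.
    by rewrite (le_trans h)// ler_pdivrMr// ler_peMr ?ltW// ltr1n.
  by rewrite (le_lt_trans m1).
rewrite ge0_integral_setU//; last 2 first.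
  by apply: mw; exact: measurableU.
  rewrite /disj_set; apply/eqP; rewrite -subset0 => x [/= /andP[_ h1] /andP[h2 _]].
  by move: (lt_le_trans h2 h1); rewrite ltxx.
apply: (le_trans (leeD (IH _ r20) (shell_le r0))).
rewrite -EFinD lee_fin powR_half// mulrA -mulrDl.
apply: ler_wpM2r; first exact: powR_ge0.
rewrite le_eqVlt; apply/orP; left; apply/eqP; rewrite /L.
by field; rewrite subr_eq0 gt_eqF.
Qed.

(** Monotone convergence over finite unions of shells. The shells never reach points with
    [N x <= 0]; [measure_nonpositive_eq0] shows that these form a null set. *)
Lemma integral_weight_le : exists2 L : R, 0 <= L & forall r, 0 < r ->
  (\int[mu]_(x in [set x | 0 < N x <= r]%R) (N x `^ (- b))%:E <=
   (L * r `^ (Q%:R - b))%:E)%E.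
Proof.
have /andP[q0 q1] := q_lt1.
exists L; first by rewrite !mulr_ge0 ?invr_ge0 ?powR_ge0// subr_ge0 ltW.
move=> r r0.
pose F m := [set x | r / 2 ^+ m < N x <= r].
have FE : [set x | 0 < N x <= r] = \bigcup_m F m.
  apply/seteqP; split => x /=; last first.
    by move=> [m _] /= /andP[h ->]; rewrite (lt_trans _ h)// divr_gt0// exprn_gt0.
  (* Since [m <= 2 ^ m], an Archimedean bound of [r / N x] serves as the number of shells. *)
  move=> /andP[h1 h2]; exists (Num.bound (r / N x)) => //; rewrite /F/= h2 andbT.
  have := @archi_boundP R (r / N x) (divr_ge0 (ltW r0) (ltW h1)).
  rewrite ltr_pdivrMr ?exprn_gt0// ltr_pdivrMr// => /lt_le_trans; apply.
  rewrite mulrC; apply: ler_wpM2l; first exact: ltW.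
  by rewrite -natrX ler_nat ltnW// ltn_expl.
rewrite FE.
have cvF := @ge0_nondecreasing_set_cvg_integral _ _ _ F w mu _ (fun m => measurable_oc _ _)
  (fun m => mw (measurable_oc _ _)) (fun _ x _ => w0 x).
have ndF : nondecreasing_seq F.
  apply/nondecreasing_seqP => m; apply/subsetPset => x; rewrite /F/= => /andP[h ->].
  rewrite andbT (le_lt_trans _ h)// exprS invfM mulrA mulrAC ler_pdivrMr//.
  by rewrite ler_peMr ?ler1n// divr_ge0// ?exprn_ge0// ltW.
move: cvF => /(_ ndF) /cvg_lim <-//.
apply: lime_le; last by apply: nearW => m; exact: truncated_le.
apply: ereal_nondecreasing_is_cvgn.
apply: ge0_nondecreasing_set_nondecreasing_integral => // m.
  exact: measurable_oc.
exact: mw (measurable_oc _ _).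
Qed.

Lemma measure_nonpositive_eq0 : mu [set x | N x <= 0]%R = 0%E.
Proof.
apply/eqP; rewrite eq_le measure_ge0 andbT.
apply/lee_addgt0Pr => e e0; rewrite add0e.
(* [r <= 1] gives [r ^ Q <= r], and then [c * r <= e]; the denominator [c + 1] allows [c = 0]. *)
pose r := Num.min 1 (e / (c + 1)).
have c1 : 0 < c + 1 by rewrite ltr_wpDl.
have r0 : 0 < r by rewrite lt_min ltr01 divr_gt0.
apply: (@le_trans _ _ (mu [set x | N x <= r]%R)).
  apply: le_measure; rewrite ?inE; [exact: measurable_ball|exact: measurable_ball|].
  by move=> x /= /le_trans; apply; exact: ltW.
apply: (le_trans (ball_le r0)); rewrite lee_fin.
have Q0 : (0 < Q)%N by rewrite -(ltr_nat R) (lt_trans b0).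
have rQ : r ^+ Q <= r.
  by rewrite -[leRHS]expr1 ler_wiXn2l ?(ltW r0)// ge_min lexx.
apply: (@le_trans _ _ (c * (e / (c + 1)))).
  by apply: ler_wpM2l => //; rewrite (le_trans rQ)// ge_min lexx orbT.
by rewrite mulrA ler_pdivrMr// mulrC ler_wpM2l ?(ltW e0)// lerDl.
Qed.

End weight.

Local Open Scope complex_scope.

(** * Squared moduli and squared [L^2] norms of complex functions *)

Section normc2.
Context {R : realType}.
Implicit Types z : R[i].

Definition normc2 z : R := complex.Re z ^+ 2 + complex.Im z ^+ 2.

Lemma normc2_ge0 z : 0 <= normc2 z.
Proof. by rewrite addr_ge0 ?sqr_ge0. Qed.

Lemma normc2E z : normc2 z = ComplexField.Normc.normc z ^+ 2.
Proof. by case: z => a b; rewrite /= sqr_sqrtr// addr_ge0 ?sqr_ge0. Qed.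

Lemma normc2M z1 z2 : normc2 (z1 * z2) = normc2 z1 * normc2 z2.
Proof. by rewrite !normc2E ComplexField.Normc.normcM exprMn. Qed.

Lemma ReB z1 z2 : complex.Re (z1 - z2) = complex.Re z1 - complex.Re z2.
Proof. by case: z1 z2 => [a b] [c d]. Qed.

Lemma ImB z1 z2 : complex.Im (z1 - z2) = complex.Im z1 - complex.Im z2.
Proof. by case: z1 z2 => [a b] [c d]. Qed.

Lemma normc2_le2 z1 z2 z3 :
  normc2 (z1 - z3) <= 2 * (normc2 (z1 - z2) + normc2 (z2 - z3)).
Proof.
rewrite /normc2 !ReB !ImB.
case: z1 z2 z3 => [a1 b1] [a2 b2] [a3 b3] /=.
have := sqr_ge0 ((a1 - a2) - (a2 - a3)); have := sqr_ge0 ((b1 - b2) - (b2 - b3)); nra.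
Qed.

Lemma normc2_le3 z1 z2 z3 z4 :
  normc2 (z1 - z4) <= 3 * (normc2 (z1 - z2) + normc2 (z2 - z3) + normc2 (z3 - z4)).
Proof.
have H (a b c : R) : (a + b + c) ^+ 2 <= 3 * (a ^+ 2 + b ^+ 2 + c ^+ 2).
  have := sqr_ge0 (a - b); have := sqr_ge0 (b - c); have := sqr_ge0 (a - c); nra.
rewrite /normc2 !ReB !ImB.
set a1 := complex.Re z1; set b1 := complex.Im z1.
set a2 := complex.Re z2; set b2 := complex.Im z2.
set a3 := complex.Re z3; set b3 := complex.Im z3.
set a4 := complex.Re z4; set b4 := complex.Im z4.
have := H (a1 - a2) (a2 - a3) (a3 - a4); have := H (b1 - b2) (b2 - b3) (b3 - b4).
rewrite !addrA !subrK; lra.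
Qed.

End normc2.

Section energy.
Local Open Scope ereal_scope.
Context d (T : measurableType d) (R : realType).
Variable mu : {measure set T -> \bar R}.
Implicit Types h : T -> R[i].

Definition energy h : \bar R := \int[mu]_x (normc2 (h x))%:E.

Lemma CLnorm2_sqr h : CLnorm mu 2 h ^+ 2 = energy h.
Proof.
rewrite /CLnorm (Lnorm2_sqr mu (fun x => ComplexField.Normc.normc (h x))).
by apply: eq_integral => x _; rewrite normc2E.
Qed.

Lemma energy_ge0 h : 0 <= energy h.
Proof. by apply: integral_ge0 => x _; rewrite lee_fin normc2_ge0. Qed.

Lemma measurable_normc2 h : cmeasurable h ->
  measurable_fun setT (fun x => normc2 (h x)).
Proof. by move=> [mr mi]; apply: measurable_funD; exact: measurable_funX. Qed.

Lemma measurable_normc2E h : cmeasurable h ->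
  measurable_fun setT (fun x => (normc2 (h x))%:E).
Proof. by move=> mh; apply/measurable_EFinP; exact: measurable_normc2. Qed.

Lemma cmeasurableB h1 h2 : cmeasurable h1 -> cmeasurable h2 ->
  cmeasurable (h1 \- h2)%R.
Proof.
move=> [mr1 mi1] [mr2 mi2]; split => /=.
  by under eq_fun do rewrite ReB; exact: measurable_funB.
by under eq_fun do rewrite ImB; exact: measurable_funB.
Qed.

Lemma inCLp2P h : inCLp mu 2 h <-> cmeasurable h /\ energy h < +oo.
Proof.
rewrite /inCLp -CLnorm2_sqr; split => -[mh hoo]; split => //.
  by rewrite expe2 lte_mul_pinfty// ?Lnorm_ge0// ge0_fin_numE ?Lnorm_ge0.
move: hoo; rewrite !ltey; apply: contraNN => /eqP ->.
by rewrite expe2 mulyy.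
Qed.

Lemma inCL1_integrable h : inCLp mu 1 h ->
  mu.-integrable setT (EFin \o (fun x => complex.Re (h x))) /\
  mu.-integrable setT (EFin \o (fun x => complex.Im (h x))).
Proof.
move=> [[mr mi]]; rewrite /CLnorm Lnorm1 => hoo.
have mn : measurable_fun setT (fun x => (ComplexField.Normc.normc (h x))%:E).
  apply/measurable_EFinP.
  rewrite (_ : (fun x => _) = (fun x => Num.sqrt (normc2 (h x)))); last first.
    by apply/funext => x; rewrite /normc2; case: (h x).
  apply: measurableT_comp; last exact: measurable_normc2.
  by apply: continuous_measurable_fun; exact: sqrt_continuous.
have ni : mu.-integrable setT (fun x => (ComplexField.Normc.normc (h x))%:E).
  by apply/integrableP.
split; apply: (le_integrable measurableT _ _ ni); first exact/measurable_EFinP.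
- move=> x _ /=; rewrite lee_fin -!sqrtr_sqr; case: (h x) => a b /=.
  by rewrite ler_sqrt ?sqr_ge0// sqr_sqrtr ?addr_ge0 ?sqr_ge0// lerDl sqr_ge0.
- exact/measurable_EFinP.
- move=> x _ /=; rewrite lee_fin -!sqrtr_sqr; case: (h x) => a b /=.
  by rewrite ler_sqrt ?sqr_ge0// sqr_sqrtr ?addr_ge0 ?sqr_ge0// lerDr sqr_ge0.
Qed.

End energy.

Lemma ereal_cvg0_lt (R : realType) (u : nat -> \bar R) (e : R) : (0 < e) ->
  u k @[k --> \oo] --> 0%E -> \forall k \near \oo, (u k < e%:E)%E.
Proof. by move=> e0 u0; apply: (u0 [set x | (x < e%:E)%E]); exact: open_ereal_lt'. Qed.

(** * The Fourier transform *)

Section fourier1.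
Context {R : realType} {n : nat}.
Local Notation H := (heisenberg R n).
Local Notation mu := (haar R n).
Variables (K : R) (W : nat -> H -> R).
Let phi (X Y : H) : R := 2 * pi * inner X Y.
Hypothesis sk : summability_kernel mu phi K W.

Definition cintegrable (h : H -> R[i]) :=
  mu.-integrable setT (EFin \o (fun x => complex.Re (h x))) /\
  mu.-integrable setT (EFin \o (fun x => complex.Im (h x))).

Lemma cintegrable_measurable h : cintegrable h -> cmeasurable h.
Proof. by move=> [/measurable_int/measurable_EFinP + /measurable_int/measurable_EFinP]. Qed.

Lemma cintegrableB h1 h2 : cintegrable h1 -> cintegrable h2 ->
  cintegrable (h1 \- h2).
Proof.
move=> [r1 i1] [r2 i2]; split.
  by apply: eq_integrable (integrableB measurableT r1 r2) => // x _; rewrite /= ReB.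
by apply: eq_integrable (integrableB measurableT i1 i2) => // x _; rewrite /= ImB.
Qed.

Let measurable_phi xi : measurable_fun setT (phi xi).
Proof.
exact: (measurableT_comp (sk_phi sk) (g := fun x => (xi, x)) (pair1_measurable xi)).
Qed.

Let integrable_cos (u : H -> R) xi : mu.-integrable setT (EFin \o u) ->
  mu.-integrable setT (EFin \o (fun x => u x * cos (phi xi x))).
Proof.
move=> ui; apply: integrable_mul_bounded => //; last by move=> x; exact: cos_le1_norm.
by apply: measurableT_comp => //; exact: measurable_cos.
Qed.

Let integrable_sin (u : H -> R) xi : mu.-integrable setT (EFin \o u) ->
  mu.-integrable setT (EFin \o (fun x => u x * sin (phi xi x))).
Proof.
move=> ui; apply: integrable_mul_bounded => //; last by move=> x; exact: sin_le1_norm.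
by apply: measurableT_comp => //; exact: measurable_sin.
Qed.

Let C (u : H -> R) := cos_transform mu phi u.
Let S (u : H -> R) := sin_transform mu phi u.

Let fourier1_Re h xi : cintegrable h ->
  complex.Re (fourier1 h xi) =
  C (fun x => complex.Re (h x)) xi + S (fun x => complex.Im (h x)) xi.
Proof.
move=> [hr hi]; rewrite /fourier1 /Cintegral/=.
rewrite -[RHS]RintegralD//; [|exact: integrable_cos|exact: integrable_sin].
apply: eq_Rintegral => x _; case: (h x) => a b /=.
by rewrite /phi mulrN opprK.
Qed.

Let fourier1_Im h xi : cintegrable h ->
  complex.Im (fourier1 h xi) =
  C (fun x => complex.Im (h x)) xi - S (fun x => complex.Re (h x)) xi.
Proof.
move=> [hr hi]; rewrite /fourier1 /Cintegral/=.
rewrite -[RHS]RintegralB//; [|exact: integrable_cos|exact: integrable_sin].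
apply: eq_Rintegral => x _; case: (h x) => a b /=.
by rewrite /phi mulrN addrC.
Qed.

Lemma cmeasurable_fourier1 h : cintegrable h -> cmeasurable (fourier1 h).
Proof.
move=> hi; have [hr him] := hi; split.
  under eq_fun do rewrite fourier1_Re//.
  by apply: measurable_funD; [exact: (measurable_cos_transform sk)|exact: (measurable_sin_transform sk)].
under eq_fun do rewrite fourier1_Im//.
by apply: measurable_funB; [exact: (measurable_cos_transform sk)|exact: (measurable_sin_transform sk)].
Qed.

Lemma fourier1B h1 h2 xi : cintegrable h1 -> cintegrable h2 ->
  fourier1 (h1 \- h2) xi = fourier1 h1 xi - fourier1 h2 xi.
Proof.
move=> h1i h2i; apply/eqP; rewrite eq_complex ReB ImB.
rewrite !fourier1_Re ?fourier1_Im//; [|exact: cintegrableB|exact: cintegrableB].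
have [h1r h1m] := h1i; have [h2r h2m] := h2i.
have CB (u v : H -> R) : mu.-integrable setT (EFin \o u) ->
    mu.-integrable setT (EFin \o v) -> C (fun x => u x - v x) xi = C u xi - C v xi.
  move=> ui vi; rewrite -[RHS]RintegralB//; [|exact: integrable_cos|exact: integrable_cos].
  by apply: eq_Rintegral => x _; rewrite mulrBl.
have SB (u v : H -> R) : mu.-integrable setT (EFin \o u) ->
    mu.-integrable setT (EFin \o v) -> S (fun x => u x - v x) xi = S u xi - S v xi.
  move=> ui vi; rewrite -[RHS]RintegralB//; [|exact: integrable_sin|exact: integrable_sin].
  by apply: eq_Rintegral => x _; rewrite mulrBl.
have eR : (fun x => complex.Re ((h1 \- h2) x)) =
  (fun x => complex.Re (h1 x) - complex.Re (h2 x)) by apply/funext => x; rewrite ReB.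
have eI : (fun x => complex.Im ((h1 \- h2) x)) =
  (fun x => complex.Im (h1 x) - complex.Im (h2 x)) by apply/funext => x; rewrite ImB.
rewrite eR eI !CB// !SB//; apply/andP; split; apply/eqP; ring.
Qed.

Lemma normc2_fourier1_le h xi : cintegrable h ->
  normc2 (fourier1 h xi) <=
  2 * (\int[mu]_x `|complex.Re (h x)| + \int[mu]_x `|complex.Im (h x)|) ^+ 2.
Proof.
move=> hi; have [hr him] := hi; rewrite /normc2 fourier1_Re// fourier1_Im//.
have := cos_transform_le sk hr xi; have := sin_transform_le sk hr xi.
have := cos_transform_le sk him xi; have := sin_transform_le sk him xi.
rewrite -!/(C _) -!/(S _).
set A := \int[mu]_x _; set B := \int[mu]_x _.
rewrite !ler_norml => /andP[a1 a2] /andP[b1 b2] /andP[c1 c2] /andP[d1 d2].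
rewrite mulr_natl mulr2n; apply: lerD; rewrite -ler_sqrt ?sqr_ge0// !sqrtr_sqr.
  by rewrite [leRHS]ger0_norm ?ler_norml; [apply/andP; split|]; lra.
by rewrite [leRHS]ger0_norm ?ler_norml; [apply/andP; split|]; lra.
Qed.

(** Bessel's inequality for the real and imaginary parts of [h]. The factor 2 comes from
    [(a + b)^2 <= 2 a^2 + 2 b^2], which absorbs the cross terms between the two parts. *)
Lemma energy_fourier1_le h : cintegrable h ->
  (energy mu (fourier1 h) <= (2 * K)%:E * energy mu h)%E.
Proof.
move=> hi; have [hr him] := hi; have [mr mi] := cintegrable_measurable hi.
have Br := cos_sin_transform_bessel sk hr; have Bi := cos_sin_transform_bessel sk him.
pose cs (u : H -> R) X := (C u X ^+ 2 + S u X ^+ 2).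
have mcs u : mu.-integrable setT (EFin \o u) -> measurable_fun setT (EFin \o cs u).
  move=> ui; apply/measurable_EFinP; rewrite /cs; apply: measurable_funD.
    by apply: measurable_funX; exact: (measurable_cos_transform sk).
  by apply: measurable_funX; exact: (measurable_sin_transform sk).
have cs0 u x : (0 <= (EFin \o cs u) x)%E by rewrite lee_fin addr_ge0 ?sqr_ge0.
apply: (@le_trans _ _ (2%:E * (\int[mu]_x (cs (fun x => complex.Re (h x)) x)%:E +
    \int[mu]_x (cs (fun x => complex.Im (h x)) x)%:E))%E).
  rewrite -(ge0_integralD mu measurableT (fun x _ => cs0 _ x) (mcs _ hr)
    (fun x _ => cs0 _ x) (mcs _ him)).
  rewrite -ge0_integralZl//; last 2 first.
    by apply: emeasurable_funD; exact: mcs.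
    by move=> x _; rewrite adde_ge0.
  apply: ge0_le_integral => //.
  - by move=> x _; rewrite lee_fin normc2_ge0.
  - by apply: measurable_normc2E; exact: cmeasurable_fourier1.
  - apply: emeasurable_funM; first exact: measurable_cst.
    by apply: emeasurable_funD; exact: mcs.
  - move=> x _; rewrite -EFinD -EFinM lee_fin /normc2 fourier1_Re// fourier1_Im// /cs.
    set a := C _ x; set b := S _ x; set a' := C _ x; set b' := S _ x.
    have := sqr_ge0 (a - b); have := sqr_ge0 (a' + b'); nra.
rewrite EFinM -muleA; apply: lee_wpmul2l => //.
apply: (le_trans (leeD Br Bi)).
rewrite -ge0_muleDr; last 2 first.
  by apply: integral_ge0 => x _; rewrite lee_fin sqr_ge0.
  by apply: integral_ge0 => x _; rewrite lee_fin sqr_ge0.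
apply: lee_wpmul2l; first by rewrite lee_fin (sk_bound_ge0 sk).
rewrite -ge0_integralD//.
- by move=> x _; rewrite lee_fin sqr_ge0.
- by apply/measurable_EFinP/measurable_funX.
- by move=> x _; rewrite lee_fin sqr_ge0.
- by apply/measurable_EFinP/measurable_funX.
Qed.

Section approximation.
Variables (f hh : H -> R[i]).
Hypothesis mf : cmeasurable f.
Hypothesis fhh : is_fourier2 f hh.

(* Split [hh = (hh - fourier1 (u k)) + fourier1 v + fourier1 (u k - v)] with
   [u k] tending to [f]. *)
Lemma is_fourier2_le (v : H -> R[i]) (E : set H) (M : R) :
  cintegrable v -> measurable E -> 0 <= M ->
  (forall xi, normc2 (fourier1 v xi) <= M) ->
  (\int[mu]_(x in E) (normc2 (hh x))%:E <=
   (3 * M)%:E * mu E + (12 * K)%:E * energy mu (f \- v)%R)%E.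
Proof.
move=> vi mE M0 vM; have [/inCLp2P[mhh _] [u [uL ucvg uhcvg]]] := fhh.
have K0 := sk_bound_ge0 sk.
have [mvr mvi] := cintegrable_measurable vi; have mv : cmeasurable v by split.
apply/lee_addgt0Pr => e e0.
(* [D] collects the coefficients of the approximation error [s ^+ 2]: 3 from [hh - fourier1 (u k)],
   and [3 * 2 K * 2] from the energy of [u k - v], compared with that of [f - v]. The choice of [s]
   makes [D * s ^+ 2 <= e]. *)
pose D := 3 + 12 * K; have D0 : 0 < D by rewrite /D; lra.
pose s := Num.min 1 (e / D).
have s0 : 0 < s by rewrite lt_min ltr01 divr_gt0.
have ss : s ^+ 2 <= e / D.
  rewrite expr2 (@le_trans _ _ (1 * s))//.
    by apply: ler_wpM2r; [exact: ltW|rewrite ge_min lexx].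
  by rewrite mul1r ge_min lexx orbT.
have [k [k1 k2]] : exists k, (CLnorm mu 2 (u k \- f)%R < s%:E)%E /\
    (CLnorm mu 2 (fourier1 (u k) \- hh)%R < s%:E)%E.
  by have [k _ /(_ k (leqnn k))] := filterI (ereal_cvg0_lt s0 ucvg) (ereal_cvg0_lt s0 uhcvg);
    exists k.
have sqr_lt (h : H -> R[i]) : (CLnorm mu 2 h < s%:E)%E -> (energy mu h <= (s ^+ 2)%:E)%E.
  move=> hs; rewrite -CLnorm2_sqr EFin_expe lee_sqr; first exact: ltW.
    exact: Lnorm_ge0.
  by rewrite lee_fin ltW.
have {}k1 := sqr_lt _ k1; have {}k2 := sqr_lt _ k2.
have uki := inCL1_integrable (uL k).1.
have mu_k := cintegrable_measurable uki.
have wi : cintegrable (u k \- v)%R by exact: cintegrableB.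
have muh : cmeasurable (fourier1 (u k)) by exact: cmeasurable_fourier1.
have mvh : cmeasurable (fourier1 v) by exact: cmeasurable_fourier1.
have mwh : cmeasurable (fourier1 (u k \- v)%R) by exact: cmeasurable_fourier1.
pose a x := (normc2 ((fourier1 (u k) \- hh)%R x))%:E.
pose b x := (normc2 (fourier1 (u k \- v)%R x))%:E.
have ma : measurable_fun setT a by apply: measurable_normc2E; exact: cmeasurableB.
have mb : measurable_fun setT b by exact: measurable_normc2E.
have a0 x : (0 <= a x)%E by rewrite lee_fin normc2_ge0.
have b0 x : (0 <= b x)%E by rewrite lee_fin normc2_ge0.
have step1 : (\int[mu]_(x in E) (normc2 (hh x))%:E <=
    3%:E * (energy mu (fourier1 (u k) \- hh)%R + M%:E * mu E +
            energy mu (fourier1 (u k \- v)%R)))%E.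
  have aM0 x : (0 <= a x + M%:E)%E by rewrite adde_ge0// lee_fin.
  have maM : measurable_fun setT (fun x => a x + M%:E)%E.
    by apply: emeasurable_funD => //; exact: measurable_cst.
  apply: (@le_trans _ _ (\int[mu]_(x in E) (3%:E * (a x + M%:E + b x)))%E).
    apply: ge0_le_integral => //.
    - by move=> x _; rewrite lee_fin normc2_ge0.
    - by apply: (measurable_funS measurableT) => //; exact: measurable_normc2E.
    - apply: (measurable_funS measurableT) => //.
      apply: emeasurable_funM; first exact: measurable_cst.
      exact: (emeasurable_funD maM mb).
    - move=> x _; rewrite /a /b -!EFinD -EFinM lee_fin fourier1B//=.
      have nN (z w : R[i]) : normc2 (z - w) = normc2 (w - z).
        by case: z w => [z1 z2] [w1 w2]; rewrite /normc2/=; ring.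
      (* The consecutive differences of these four points are the three pieces of the splitting. *)
      have := normc2_le3 (hh x) (fourier1 (u k) x) (fourier1 (u k) x - fourier1 v x) 0.
      have -> : fourier1 (u k) x - (fourier1 (u k) x - fourier1 v x) = fourier1 v x.
        by rewrite opprB addrC subrK.
      rewrite !subr0 (nN (hh x)) => /le_trans; apply.
      by apply: ler_wpM2l => //; rewrite lerD2r lerD2l vM.
  have E_le (g : H -> \bar R) : measurable_fun setT g -> (forall x, 0 <= g x)%E ->
      (\int[mu]_(x in E) g x <= \int[mu]_x g x)%E.
    by move=> mg g0; apply: ge0_subset_integral.
  have mES (g : H -> \bar R) : measurable_fun setT g -> measurable_fun E g.
    by move=> mg; exact: (measurable_funS measurableT).
  rewrite ge0_integralZl//; last 2 first.
  - by apply: mES; exact: (emeasurable_funD maM mb).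
  - by move=> x _; rewrite adde_ge0.
  apply: lee_wpmul2l => //.
  rewrite (ge0_integralD mu mE (fun x _ => aM0 x) (mES _ maM) (fun x _ => b0 x) (mES _ mb)).
  have M0' : (0 <= M%:E)%E by rewrite lee_fin.
  have mM : measurable_fun E (fun=> M%:E) by exact: measurable_cst.
  rewrite (ge0_integralD mu mE (fun x _ => a0 x) (mES _ ma) (fun _ _ => M0') mM).
  rewrite integral_cst//.
  by apply: leeD; [apply: leeD => //; exact: E_le|exact: E_le].
have step2 : (energy mu (u k \- v)%R <= 2%:E * ((s ^+ 2)%:E + energy mu (f \- v)%R))%E.
  apply: (@le_trans _ _ (2%:E * (energy mu (u k \- f)%R + energy mu (f \- v)%R))%E); last first.
    by apply: lee_wpmul2l => //; exact: leeD.
  have m1 := measurable_normc2E (cmeasurableB mu_k mf).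
  have m2 := measurable_normc2E (cmeasurableB mf mv).
  rewrite /energy -ge0_integralD//; last 2 first.
  - by move=> x _; rewrite lee_fin normc2_ge0.
  - by move=> x _; rewrite lee_fin normc2_ge0.
  rewrite -ge0_integralZl//; last 2 first.
  - exact: emeasurable_funD.
  - by move=> x _; rewrite -EFinD lee_fin addr_ge0 ?normc2_ge0.
  apply: ge0_le_integral => //.
  - by move=> x _; rewrite lee_fin normc2_ge0.
  - by apply: measurable_normc2E; exact: cmeasurableB.
  - by apply: emeasurable_funM; [exact: measurable_cst|exact: emeasurable_funD].
  - by move=> x _; rewrite -EFinD -EFinM lee_fin normc2_le2.
have F0 := energy_ge0 mu (f \- v)%R.
apply: (le_trans step1).
apply: (@le_trans _ _ (3%:E * ((s ^+ 2)%:E + M%:E * mu E +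
    (2 * K)%:E * (2%:E * ((s ^+ 2)%:E + energy mu (f \- v)%R))))%E).
  apply: lee_wpmul2l => //; apply: leeD; first by apply: leeD.
  apply: (le_trans (energy_fourier1_le wi)); apply: lee_wpmul2l => //.
  by rewrite lee_fin mulr_ge0.
have Y0 : (0 <= M%:E * mu E)%E by rewrite mule_ge0.
have s20 : (0 <= (s ^+ 2)%:E)%E by rewrite lee_fin sqr_ge0.
have -> : ((3 * M)%:E * mu E = 3%:E * (M%:E * mu E))%E by rewrite EFinM muleA.
move: F0 Y0; set F := energy mu _; set Y := (M%:E * mu E)%E => F0 Y0.
have P0 : (0 <= (2 * K)%:E * (2%:E * (s ^+ 2)%:E))%E.
  by rewrite !mule_ge0// lee_fin mulr_ge0.
have Q0 : (0 <= (2 * K)%:E * (2%:E * F))%E by rewrite !mule_ge0// lee_fin mulr_ge0.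
have p0 : (0 <= 2%:E * (s ^+ 2)%:E)%E by rewrite mule_ge0.
have q0 : (0 <= 2%:E * F)%E by rewrite mule_ge0.
rewrite (ge0_muleDr _ s20 F0) (ge0_muleDr _ p0 q0).
rewrite (ge0_muleDr _ (adde_ge0 s20 Y0) (adde_ge0 P0 Q0)).
rewrite (ge0_muleDr _ s20 Y0) (ge0_muleDr _ P0 Q0) addeACA addeC.
apply: leeD; last first.
  rewrite -!EFinM -EFinD lee_fin.
  rewrite (_ : _ + _ = D * s ^+ 2); last by rewrite /D; ring.
  by rewrite mulrC -ler_pdivlMr.
rewrite leeD2l// !muleA -!EFinM.
by rewrite (_ : 3 * (2 * K) * 2 = 12 * K)//; ring.
Qed.

End approximation.

End fourier1.

(** * The uncertainty principle *)

Section uncertainty.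
Context {R : realType} {n : nat}.
Local Notation H := (heisenberg R n).
Local Notation mu := (haar R n).
Local Notation N := (@koranyi R n).
Local Notation Q := (homogeneous_dim n).
Variables (K : R) (W : nat -> H -> R).
Let phi (X Y : H) : R := 2 * pi * inner X Y.
Hypothesis sk : summability_kernel mu phi K W.
Variable alpha : R.
Hypothesis alpha0 : 0 < alpha.
Hypothesis alphaQ : alpha < Q%:R / 2.

Let c : R := 2 ^+ (2 * n + 1).
Let c0 : 0 <= c. Proof. exact: exprn_ge0. Qed.
Let ball_le (r : R) : 0 < r -> (mu [set X | N X <= r]%R <= (c * r ^+ Q)%:E)%E.
Proof. exact: haar_koranyi_ball. Qed.

Let alpha2_gt0 : 0 < 2 * alpha. Proof. by rewrite mulr_gt0. Qed.

Let alpha2_lt : 2 * alpha < Q%:R.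
Proof. by rewrite mulrC -ltr_pdivlMr. Qed.

Let mu_zero : mu [set X | N X <= 0]%R = 0%E.
Proof. exact: measure_nonpositive_eq0 (@measurable_koranyi R n) c0 alpha2_gt0 alpha2_lt ball_le. Qed.

Let measurable_ball (r : R) : measurable [set X | N X <= r].
Proof.
have := @measurable_koranyi R n measurableT _ (measurable_itv `]-oo, r]).
by rewrite setTI; congr measurable; apply/seteqP; split => p/=; rewrite in_itv.
Qed.

Let ae_gt0 : {ae mu, forall X, 0 < N X}.
Proof.
exists [set X | N X <= 0]; split => //.
by move=> X /= /negP; rewrite -leNgt.
Qed.

Lemma normc2_weight (h : H -> R[i]) X :
  normc2 (koranyi_weight alpha h X) = N X `^ (2 * alpha) * normc2 (h X).
Proof.
rewrite /koranyi_weight normc2M; congr (_ * _).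
rewrite /normc2/= expr0n/= addr0 -powR_mulrn ?powR_ge0// -powRrM.
by rewrite mulrC.
Qed.

Let mNp (b : R) : measurable_fun setT (fun X : H => N X `^ b).
Proof. exact: (measurableT_comp (measurable_powR _) (@measurable_koranyi R n)). Qed.

Lemma measurable_normc2_weight (h : H -> R[i]) : cmeasurable h ->
  measurable_fun setT (fun X => (normc2 (koranyi_weight alpha h X))%:E).
Proof.
move=> mh; under eq_fun do rewrite normc2_weight.
by apply/measurable_EFinP/measurable_funM => //; exact: measurable_normc2.
Qed.

(** The weight is positive outside a null set. This is what keeps the weighted norms nonzero when
    the radius is optimized. *)
Lemma energy_weight_eq0 (h : H -> R[i]) : cmeasurable h ->
  energy mu (koranyi_weight alpha h) = 0%E -> energy mu h = 0%E.
Proof.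
move=> mh e0; rewrite -(integral0 mu setT).
apply: ge0_ae_eq_integral => //.
- exact: measurable_normc2E.
- by move=> x _; rewrite lee_fin normc2_ge0.
have : (\int[mu]_X `|(normc2 (koranyi_weight alpha h X))%:E| = 0)%E.
  by rewrite -e0; apply: eq_integral => X _; rewrite gee0_abs// lee_fin normc2_ge0.
move=> /(ae_eq_integral_abs mu measurableT (measurable_normc2_weight mh)).
move: ae_gt0; apply: filterS2 => X NX0 /(_ I) /= + _.
rewrite normc2_weight => -[] /eqP; rewrite mulf_eq0 gt_eqF ?powR_gt0//= => /eqP ->.
by [].
Qed.

(** Chebyshev's inequality: [1 <= r ^ (- 2 alpha) * N X ^ (2 alpha)] where [N X > r]. It is applied
    to [f] at radius [r] and to its transform at radius [1 / r]. *)
Let energy_outside (h : H -> R[i]) (r : R) : cmeasurable h -> 0 < r ->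
  (\int[mu]_(X in ~` [set X | N X <= r]%R) (normc2 (h X))%:E <=
   (r `^ (- (2 * alpha)))%:E * energy mu (koranyi_weight alpha h))%E.
Proof.
move=> mh r0.
rewrite /energy -ge0_integralZl//; last 3 first.
- exact: measurable_normc2_weight.
- by move=> x _; rewrite lee_fin normc2_ge0.
- by rewrite lee_fin powR_ge0.
rewrite [leLHS]integral_mkcond; apply: ge0_le_integral => //.
- move=> X _; rewrite erestrict_ge0// => x _; rewrite lee_fin normc2_ge0//.
- apply/(measurable_restrictT _ (measurableC (measurable_ball r))).
  by apply: (measurable_funS measurableT) => //; exact: measurable_normc2E.
- apply: emeasurable_funM; first exact: measurable_cst.
  exact: measurable_normc2_weight.
- move=> X _; rewrite patchE; case: ifPn => [|_]; last first.
    by rewrite -EFinM lee_fin mulr_ge0 ?normc2_ge0// powR_ge0.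
  rewrite inE/= => /negP; rewrite -ltNge => rX.
  rewrite -EFinM lee_fin normc2_weight mulrA ler_peMl ?normc2_ge0//.
  rewrite powRN mulrC ler_pdivlMr ?powR_gt0// mul1r.
  by apply: ge0_ler_powR; rewrite ?nnegrE ?koranyi_ge0 ?(ltW r0) ?(ltW rX) ?(ltW alpha2_gt0).
Qed.


(** The ball without the origin, so that [N ^ alpha * N ^ (- alpha) = 1] on it. The removed set is
    null. *)
Let S (r : R) : set H := [set X | 0 < N X <= r].

Let measurable_S r : measurable (S r).
Proof.
have := @measurable_koranyi R n measurableT _ (measurable_itv `]0, r]).
by rewrite setTI; congr measurable; apply/seteqP; split => p/=; rewrite in_itv.
Qed.

Let trunc (r : R) (h : H -> R[i]) (X : H) : R[i] := (\1_(S r) X : R)%:C * h X.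

Let Re_trunc r h X : complex.Re (trunc r h X) = \1_(S r) X * complex.Re (h X).
Proof. by rewrite /trunc; case: (h X) => a b /=; rewrite mul0r subr0. Qed.

Let Im_trunc r h X : complex.Im (trunc r h X) = \1_(S r) X * complex.Im (h X).
Proof. by rewrite /trunc; case: (h X) => a b /=; rewrite mul0r addr0. Qed.

(* Cauchy-Schwarz against the weight [N ^ (- alpha)], which is square integrable
   on balls because [2 * alpha < Q]. *)
Let truncated_L1 (L r : R) (u : H -> R) : measurable_fun setT u ->
  (\int[mu]_(x in S r) (N x `^ (- (2 * alpha)))%:E <= L%:E)%E ->
  ((\int[mu]_X `|\1_(S r) X * u X|%:E) ^+ 2 <=
   L%:E * \int[mu]_X (N X `^ (2 * alpha) * u X ^+ 2)%:E)%E.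
Proof.
move=> mu_ hL; have mS := measurable_S r.
pose f X := N X `^ alpha * u X.
pose g X := \1_(S r) X * N X `^ (- alpha).
have mf : measurable_fun setT f by exact: measurable_funM.
have mg : measurable_fun setT g by apply: measurable_funM.
have p2 (x b : R) : (x `^ b) ^+ 2 = x `^ (2 * b).
  by rewrite -powR_mulrn ?powR_ge0// -powRrM mulrC.
rewrite (eq_integral (fun X => (`|f X * g X|)%:E)); last first.
  move=> X _; rewrite /f /g; have [XS|XS] := boolP (X \in S r).
    rewrite indicE XS !mul1r powRN mulrAC mulfV ?mul1r//.
    by move: XS; rewrite inE/= => /andP[NX _]; rewrite gt_eqF ?powR_gt0.
  by rewrite indicE (negbTE XS) !mul0r mulr0.
apply: (le_trans (cauchy_schwarz mu mf mg)).
rewrite muleC (eq_integral (fun X => (N X `^ (2 * alpha) * u X ^+ 2)%:E)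
  (fun X => (f X ^+ 2)%:E)); last first.
  by move=> X _; rewrite /f exprMn p2.
apply: lee_wpmul2r.
  by apply: integral_ge0 => X _; rewrite lee_fin mulr_ge0 ?powR_ge0 ?sqr_ge0.
apply: le_trans hL; rewrite [leRHS]integral_mkcond le_eqVlt; apply/orP; left.
apply/eqP; apply: eq_integral => X _; rewrite patchE /g indicE.
by case: (X \in S r); rewrite ?mul0r ?expr0n// mul1r p2 mulrN.
Qed.

Lemma fourier_uncertainty : exists2 C : R, 0 < C &
  forall f hh : H -> R[i], inCLp mu 2 f -> is_fourier2 f hh ->
  forall r, 0 < r ->
  (energy mu hh <=
   (C * r `^ (- (2 * alpha)))%:E * energy mu (koranyi_weight alpha f) +
   (r `^ (2 * alpha))%:E * energy mu (koranyi_weight alpha hh))%E.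
Proof.
have [L L0 wL] := integral_weight_le (@measurable_koranyi R n) c0 alpha2_gt0 alpha2_lt ball_le.
have K0 := sk_bound_ge0 sk.
(* [24 L c] is the contribution of the truncation: 3 from [is_fourier2_le] times 8 from the
   pointwise bound [vM]. [12 K] is the contribution of the remainder, and 1 ensures positivity. *)
exists (24 * L * c + 12 * K + 1).
  by rewrite ltr_wpDl// addr_ge0// !mulr_ge0.
set C := _ + 1; have C0 : 0 < C by rewrite ltr_wpDl// addr_ge0// !mulr_ge0.
move=> f hh /inCLp2P[mf fL] fhh r r0; have [/inCLp2P[mhh _] _] := fhh.
set A := energy mu (koranyi_weight alpha f).
set B := energy mu (koranyi_weight alpha hh).
have A0 : (0 <= A)%E by exact: energy_ge0.
have B0 : (0 <= B)%E by exact: energy_ge0.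
have rp : 0 < r `^ (- (2 * alpha)) by rewrite powR_gt0.
(* An infinite [A] makes the bound trivial; a finite one makes the truncation [v] integrable. *)
have [Aoo|Afin] := eqVneq A +oo%E.
  rewrite Aoo gt0_muley ?lte_fin ?mulr_gt0// addye ?leey//.
  by rewrite gt_eqF// (lt_le_trans (ltNyr 0))// mule_ge0// lee_fin powR_ge0.
have {Afin} : A \is a fin_num by rewrite ge0_fin_numE// lt_neqAle Afin leey.
move=> /fineK; set a := fine A => aA.
have a0 : 0 <= a by rewrite fine_ge0.
(* Bound given by [truncated_L1] for the squared [L^1] norms of the real and imaginary parts of
   [v]. *)
pose G := L * r `^ (Q%:R - 2 * alpha) * a.
have G0 : 0 <= G by rewrite !mulr_ge0// powR_ge0.
pose v := trunc r f.
have le_u (u : H -> R) : measurable_fun setT u -> (forall X, u X ^+ 2 <= normc2 (f X)) ->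
    mu.-integrable setT (EFin \o (fun X => \1_(S r) X * u X)) /\
    (\int[mu]_X `|\1_(S r) X * u X|) ^+ 2 <= G.
  move=> mu_ uf.
  have h : ((\int[mu]_X `|\1_(S r) X * u X|%:E) ^+ 2 <= G%:E)%E.
    apply: (le_trans (truncated_L1 mu_ (wL r r0))).
    rewrite /G [leRHS]EFinM aA; apply: lee_wpmul2l.
      by rewrite lee_fin mulr_ge0// powR_ge0.
    apply: ge0_le_integral => //.
    - by move=> X _; rewrite lee_fin mulr_ge0 ?powR_ge0 ?sqr_ge0.
    - by apply/measurable_EFinP/measurable_funM => //; exact: measurable_funX.
    - exact: measurable_normc2_weight.
    - by move=> X _; rewrite lee_fin normc2_weight ler_wpM2l// powR_ge0.
  have I0 : (0 <= \int[mu]_X `|\1_(S r) X * u X|%:E)%E by exact: integral_ge0.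
  have Ioo : (\int[mu]_X `|\1_(S r) X * u X|%:E < +oo)%E.
    rewrite ltey; apply/eqP => E.
    by move: h; rewrite E expe2 mulyy leye_eq.
  split.
    apply/integrableP; split => //.
    by apply/measurable_EFinP/measurable_funM.
  rewrite -lee_fin EFin_expe fineK// ge0_fin_numE//.
have [mfr mfi] := mf.
have [vr Gr] : mu.-integrable setT (EFin \o (fun X => \1_(S r) X * complex.Re (f X))) /\
    (\int[mu]_X `|\1_(S r) X * complex.Re (f X)|) ^+ 2 <= G.
  by apply: le_u => // X; rewrite /normc2 lerDl sqr_ge0.
have [vi Gi] : mu.-integrable setT (EFin \o (fun X => \1_(S r) X * complex.Im (f X))) /\
    (\int[mu]_X `|\1_(S r) X * complex.Im (f X)|) ^+ 2 <= G.
  by apply: le_u => // X; rewrite /normc2 lerDr sqr_ge0.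
have eR : (fun X => complex.Re (v X)) = (fun X => \1_(S r) X * complex.Re (f X)).
  by apply/funext => X; exact: Re_trunc.
have eI : (fun X => complex.Im (v X)) = (fun X => \1_(S r) X * complex.Im (f X)).
  by apply/funext => X; exact: Im_trunc.
have vint : cintegrable v by rewrite /cintegrable eR eI.
have vM xi : normc2 (fourier1 v xi) <= 8 * G.
  apply: (le_trans (normc2_fourier1_le sk xi vint)).
  have -> : \int[mu]_X `|complex.Re (v X)| = \int[mu]_X `|\1_(S r) X * complex.Re (f X)|.
    by apply: eq_Rintegral => X _; rewrite -[complex.Re (v X)]/((fun X => complex.Re (v X)) X) eR.
  have -> : \int[mu]_X `|complex.Im (v X)| = \int[mu]_X `|\1_(S r) X * complex.Im (f X)|.
    by apply: eq_Rintegral => X _; rewrite -[complex.Im (v X)]/((fun X => complex.Im (v X)) X) eI.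
  move: Gr Gi; set x := \int[mu]_X _; set y := \int[mu]_X _ => Gr Gi.
  have := sqr_ge0 (x - y); nra.
have rV0 : 0 < r^-1 by rewrite invr_gt0.
have inside := is_fourier2_le sk mf fhh vint (measurable_ball r^-1)
  (mulr_ge0 (ler0n _ 8) G0) vM.
have outside := energy_outside mhh rV0.
have tail : (energy mu (f \- v)%R <= (r `^ (- (2 * alpha)))%:E * A)%E.
  apply: le_trans (energy_outside mf r0).
  rewrite [leRHS]integral_mkcond; apply: ae_ge0_le_integral => //.
  - by move=> X _; rewrite lee_fin normc2_ge0.
  - apply: measurable_normc2E; apply: cmeasurableB => //.
    exact: cintegrable_measurable.
  - by move=> X _; rewrite erestrict_ge0// => x _; rewrite lee_fin normc2_ge0.
  - apply/(measurable_restrictT _ (measurableC (measurable_ball r))).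
    by apply: (measurable_funS measurableT) => //; exact: measurable_normc2E.
  (* On the ball [f - v] vanishes wherever [N X > 0], so the comparison is only almost
     everywhere. *)
  - move: ae_gt0; apply: filterS => X NX _.
    rewrite /v /trunc patchE /=; case: ifPn => [|].
      rewrite inE/= => NXr; rewrite indicE memNset ?mul0r ?subr0//.
      by rewrite /S/= => /andP[_ /NXr].
    rewrite notin_setE/= => /contrapT NXr.
    by rewrite indicE mem_set /S/= ?NX// mul1r subrr /normc2/= expr0n/= addr0.
have -> : energy mu hh = (\int[mu]_(X in [set X | N X <= r^-1]%R) (normc2 (hh X))%:E +
    \int[mu]_(X in ~` [set X | N X <= r^-1]%R) (normc2 (hh X))%:E)%E.
  rewrite -ge0_integral_setU//.
  - by rewrite setUv.
  - exact: measurableC.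
  - by rewrite setUv; exact: measurable_normc2E.
  - by move=> x _; rewrite lee_fin normc2_ge0.
  - exact/disj_setPCl.
apply: leeD; last first.
  apply: (le_trans outside); rewrite -powR_inv1 ?(ltW r0)// -powRrM.
  by rewrite mulrNN mul1r.
apply: (le_trans inside).
apply: (@le_trans _ _ ((3 * (8 * G))%:E * (c * r^-1 ^+ Q)%:E +
    (12 * K)%:E * ((r `^ (- (2 * alpha)))%:E * A))%E).
  apply: leeD; apply: lee_wpmul2l.
  - by rewrite lee_fin; apply: mulr_ge0 => //; exact: mulr_ge0.
  - exact: ball_le.
  - by rewrite lee_fin mulr_ge0.
  - exact: tail.
rewrite -aA -!EFinM -EFinD lee_fin.
(* The volume of the ball of radius [1 / r] cancels the [r ^ Q] of [G]; this is the reason for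
   reciprocal radii. *)
have GE : G * r^-1 ^+ Q = L * r `^ (- (2 * alpha)) * a.
  rewrite /G exprVn -(powR_mulrn _ (ltW r0)) -powRN.
  rewrite powRD; last by apply/implyP => _; rewrite gt_eqF.
  rewrite [r `^ (- Q%:R)]powRN; field.
  by rewrite gt_eqF ?powR_gt0.
rewrite (_ : 3 * (8 * G) * _ = 24 * c * (G * r^-1 ^+ Q)); last by ring.
rewrite GE /C; set p := r `^ _ in rp *.
have pa : 0 <= p * a by rewrite mulr_ge0// ltW.
by rewrite -subr_ge0 [X in 0 <= X](_ : _ = p * a)//; ring.
Qed.

End uncertainty.

(** * The short-time Fourier transform *)

(** The integral of a nonnegative function is the supremum of the integrals of the simple functions
    below it, hence monotone for arbitrary functions. It will be applied to the short-time Fourier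
    transform as a function of [(Q, P)]. *)
Lemma ge0_le_integral_nonmeasurable d (T : measurableType d) (R : realType)
    (mu : {measure set T -> \bar R}) (f g : T -> \bar R) :
  (forall x, 0 <= f x)%E -> (forall x, f x <= g x)%E ->
  (\int[mu]_x f x <= \int[mu]_x g x)%E.
Proof.
move=> f0 fg; have g0 x : (0 <= g x)%E by exact: le_trans (fg x).
rewrite !ge0_integralTE//; apply: ereal_sup_le => _ [h /= hf <-].
by exists h => //= x; exact: le_trans (fg x).
Qed.

(** [fine] sends infinite values to 0, so a real integral obeys the bound by the integral of the
    modulus even when it diverges. *)
Lemma sqr_fine_le (R : realType) (x : \bar R) : ((fine x ^+ 2)%:E <= `|x| ^+ 2)%E.
Proof.
case: x => [x| |] /=; rewrite ?expr0n/= ?expe2 ?mulyy ?leey//.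
by rewrite lee_fin expr2 -normrM ler_norm.
Qed.

Section stft.
Context {R : realType} {n : nat}.
Local Notation H := (heisenberg R n).
Local Notation mu := (haar R n).

Lemma cmeasurableM d (T : measurableType d) (f g : T -> R[i]) :
  cmeasurable f -> cmeasurable g -> cmeasurable (fun x => f x * g x).
Proof.
move=> [fr fi] [gr gi]; split.
  rewrite (_ : (fun x => _) = fun x => complex.Re (f x) * complex.Re (g x) -
      complex.Im (f x) * complex.Im (g x)).
    by apply: measurable_funB; exact: measurable_funM.
  by apply/funext => x; case: (f x) (g x) => [a b] [c e].
rewrite (_ : (fun x => _) = fun x => complex.Re (f x) * complex.Im (g x) +
    complex.Im (f x) * complex.Re (g x)).
  by apply: measurable_funD; exact: measurable_funM.
by apply/funext => x; case: (f x) (g x) => [a b] [c e].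
Qed.

Lemma cmeasurable_echar (Q : H) : cmeasurable (fun X : H => echar (inner Q X)).
Proof.
have mI : measurable_fun setT (inner Q : H -> R).
  rewrite (_ : inner Q = fun X : H =>
    dot Q.1.1 X.1.1 + dot Q.1.2 X.1.2 + Q.2 * X.2); last first.
    by apply/funext => -[[p q] t]; case: Q => [[p' q'] t'].
  have mp : measurable_fun setT (fun X : H => X.1.1) by exact: measurableT_comp.
  have mq : measurable_fun setT (fun X : H => X.1.2) by exact: measurableT_comp.
  apply: measurable_funD; first apply: measurable_funD.
  - by apply: measurable_dot => //; exact: measurable_cst.
  - by apply: measurable_dot => //; exact: measurable_cst.
  - by apply: measurable_funM; [exact: measurable_cst|exact: measurable_snd].
have mi : measurable_fun setT (fun X : H => 2 * pi * inner Q X).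
  by apply: measurable_funM; first exact: measurable_cst.
split; first exact: (measurableT_comp (@measurable_cos R) mi).
rewrite /echar/=; apply: measurableT_comp => //.
exact: (measurableT_comp (@measurable_sin R) mi).
Qed.

Lemma normc2_echar (x : R) : normc2 (echar x) = 1.
Proof. by rewrite /normc2/= sqrrN cos2Dsin2. Qed.

(** The real and imaginary parts are each bounded by the integral of the modulus, hence the factor
    2. *)
Lemma normc2_Cintegral_le (h : H -> R[i]) : cmeasurable h ->
  ((normc2 (Cintegral mu h))%:E <=
   2%:E * (\int[mu]_X (Num.sqrt (normc2 (h X)))%:E) ^+ 2)%E.
Proof.
move=> [mr mi]; rewrite /normc2 /Cintegral/= EFinD.
set I := (\int[mu]_X _)%E.
have I0 : (0 <= I)%E by apply: integral_ge0 => X _; rewrite lee_fin sqrtr_ge0.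
have mn : measurable_fun setT (fun X => (Num.sqrt (normc2 (h X)))%:E).
  apply/measurable_EFinP; apply: measurableT_comp; last exact: measurable_normc2.
  by apply: continuous_measurable_fun; exact: sqrt_continuous.
have aux (u : H -> R) : measurable_fun setT u -> (forall X, u X ^+ 2 <= normc2 (h X)) ->
    (((Rintegral mu setT u) ^+ 2)%:E <= I ^+ 2)%E.
  move=> mu_ uh; apply: (le_trans (sqr_fine_le _)); rewrite lee_sqr//.
  apply: (le_trans (le_abse_integral _ _ _)) => //; first exact/measurable_EFinP.
  apply: ge0_le_integral => //.
  - by apply: measurableT_comp => //; exact/measurable_EFinP.
  - by move=> X _; rewrite lee_fin -sqrtr_sqr ler_sqrt// normc2_ge0.
have -> : (2%:E * I ^+ 2 = I ^+ 2 + I ^+ 2)%E.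
  by rewrite mule_natl mule2n.
apply: leeD; apply: aux => // X; rewrite /normc2 ?lerDl ?lerDr sqr_ge0//.
Qed.

Lemma normc2_stft_le (g f : H -> R[i]) (QP : H * H) :
  cmeasurable (fourier f) -> cmeasurable (fourier g) ->
  ((normc2 (stft g f QP))%:E <= 2%:E * (energy mu (fourier f) * energy mu (fourier g)))%E.
Proof.
case: QP => Q P mf mg; rewrite /stft/=.
set F := fourier f in mf *; set G := fourier g in mg *.
have mh := @measurable_hmul R n P.
have mGP : cmeasurable (fun X : H => G (hmul X P)).
  by have [mr mi] := mg; split; [exact: (measurableT_comp mr mh)|exact: (measurableT_comp mi mh)].
have mGc : cmeasurable (fun X : H => (G (hmul X P))^*).
  have [mr mi] := mGP; split.
    by rewrite (_ : (fun X => _) = fun X => complex.Re (G (hmul X P)))//;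
       apply/funext => X; case: (G _).
  rewrite (_ : (fun X => _) = fun X => - complex.Im (G (hmul X P))).
    exact: measurableT_comp.
  by apply/funext => X; case: (G _).
have mFG : cmeasurable (fun X => F X * (G (hmul X P))^* * echar (inner Q X)).
  by apply: cmeasurableM; [exact: cmeasurableM|exact: cmeasurable_echar].
apply: (le_trans (normc2_Cintegral_le mFG)); apply: lee_wpmul2l => //.
pose sf X := Num.sqrt (normc2 (F X)).
pose sg X := Num.sqrt (normc2 (G (hmul X P))).
have ms (k : H -> R[i]) : cmeasurable k ->
    measurable_fun setT (fun X => Num.sqrt (normc2 (k X))).
  move=> mk; apply: measurableT_comp; last exact: measurable_normc2.
  by apply: continuous_measurable_fun; exact: sqrt_continuous.
rewrite (eq_integral (fun X => `|sf X * sg X|%:E)%R); last first.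
  move=> X _; rewrite !normc2M normc2_echar mulr1 /sf /sg.
  rewrite ger0_norm ?mulr_ge0 ?sqrtr_ge0// sqrtrM ?normc2_ge0//.
  congr (_ * Num.sqrt _)%:E; rewrite /normc2; case: (G _) => a b /=.
  by rewrite sqrrN.
apply: (le_trans (cauchy_schwarz mu (ms _ mf) (ms _ mGP))).
rewrite le_eqVlt; apply/orP; left; apply/eqP; congr (_ * _)%E.
  by apply: eq_integral => X _; rewrite sqr_sqrtr// normc2_ge0.
rewrite /energy -(ge0_integral_hmul P (f := fun X => (normc2 (G X))%:E)).
- by apply: eq_integral => X _; rewrite sqr_sqrtr// normc2_ge0.
- exact: measurable_normc2E.
- by move=> X; rewrite lee_fin normc2_ge0.
Qed.

Section fourier.
Variables (K : R) (W : nat -> H -> R).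
Hypothesis sk : summability_kernel mu (fun X Y => 2 * pi * inner X Y) K W.

(** [xget] yields either a representative or the default 0; both alternatives are carried through
    below. *)
Lemma fourierP (h : H -> R[i]) : is_fourier2 h (fourier h) \/ fourier h = fun=> 0.
Proof.
rewrite /fourier; case: xgetP => [hh -> hP|_]; first by left.
by right.
Qed.

Lemma cmeasurable_fourier (h : H -> R[i]) : cmeasurable (fourier h).
Proof.
have [[/inCLp2P[]//]|->] := fourierP h.
by split; exact: measurable_cst.
Qed.

Lemma energy0 : energy mu (fun=> 0) = 0%E.
Proof. by apply: integral0_eq => X _; rewrite /normc2/= expr0n/= addr0. Qed.

(** [is_fourier2_le] with the zero truncation, [M = 0] and the whole space: [0 * +oo = 0] removes
    the first term, and what remains is Bessel's inequality for the extended transform. *)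
Lemma energy_fourier_le (h : H -> R[i]) : inCLp mu 2 h ->
  (energy mu (fourier h) <= (12 * K)%:E * energy mu h)%E.
Proof.
move=> /inCLp2P[mh _]; have [hP|->] := fourierP h; last first.
  by rewrite energy0 mule_ge0 ?energy_ge0// lee_fin mulr_ge0// (sk_bound_ge0 sk).
have zi : cintegrable (fun _ : H => 0 : R[i]).
  by split; exact: integrable0.
have z0 xi : normc2 (fourier1 (fun _ : H => 0 : R[i]) xi) <= 0.
  apply: (le_trans (normc2_fourier1_le sk xi zi)).
  have -> : \int[mu]_x `|complex.Re (0 : R[i])| = 0.
    by rewrite /= normr0 /Rintegral integral0.
  by rewrite addr0 expr0n/= mulr0.
have := is_fourier2_le sk mh hP zi measurableT (lexx 0) z0.
rewrite mulr0 mul0e add0e => /le_trans; apply.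
by rewrite (_ : (h \- (fun=> 0)) = h)//; apply/funext => X /=; rewrite subr0.
Qed.

End fourier.

End stft.


(* The measure [nu] and the map [p] stand for [lebesgue2] and the identity, whose
   carrier is only convertible to the product type. *)
Lemma stft_concentration (R : realType) (n : nat) (alpha : R) :
  0 < alpha -> alpha < (homogeneous_dim n)%:R / 2 ->
  exists2 C : R, 0 < C &
    forall g : heisenberg R n -> R[i],
      inCLp (haar R n) 2 g -> CLnorm (haar R n) 2 g = 1%E ->
    forall f : heisenberg R n -> R[i], inCLp (haar R n) 2 f ->
    forall d (T : measurableType d) (nu : {measure set T -> \bar R})
      (p : T -> heisenberg R n * heisenberg R n) (Omega : set T), measurable Omega ->
      (CLnorm nu 2 (fun x => (\1_Omega x : R)%:C * stft g f (p x))%R ^+ 2 <=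
       C%:E * nu Omega
         * CLnorm (haar R n) 2 (koranyi_weight alpha f)
         * CLnorm (haar R n) 2 (koranyi_weight alpha (fourier f)))%E.
Proof.
move=> alpha0 alphaQ.
have [K [W sk]] := @summability_kernel_haar R n.
have K0 := sk_bound_ge0 sk.
have [C C0 unc] := fourier_uncertainty sk alpha0 alphaQ.
(* [24 K = 2 * 12 K] comes from the uniform bound of the transform, with [12 K] bounding the energy
   of [fourier g]; [C + 1] comes from the uncertainty principle at the optimal radius, and the last
   1 ensures positivity. *)
exists (24 * K * (C + 1) + 1) => [|g gL g1 f fL d T nu p Omega mOmega].
  by rewrite ltr_wpDl// !mulr_ge0// addr_ge0// ltW.
set D := _ + 1.
have D0 : 0 < D by rewrite ltr_wpDl// !mulr_ge0// addr_ge0// ltW.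
set mu := haar R n.
set A := CLnorm mu 2 (koranyi_weight alpha f).
set B := CLnorm mu 2 (koranyi_weight alpha (fourier f)).
set V := nu Omega.
have A0 : (0 <= A)%E by exact: Lnorm_ge0.
have B0 : (0 <= B)%E by exact: Lnorm_ge0.
have V0 : (0 <= V)%E by exact: measure_ge0.
have mff := cmeasurable_fourier f; have mfg := cmeasurable_fourier g.
pose F := energy mu (fourier f).
have F0 : (0 <= F)%E by exact: energy_ge0.
have [mf fy] := (inCLp2P _ _).1 fL.
have FK := energy_fourier_le sk fL.
have Ffin : F \is a fin_num.
  rewrite ge0_fin_numE// (le_lt_trans FK)//.
  by rewrite lte_mul_pinfty// lee_fin mulr_ge0.
have G12 : (energy mu (fourier g) <= (12 * K)%:E)%E.
  by rewrite (le_trans (energy_fourier_le sk gL))// -CLnorm2_sqr g1 expe2 !mule1.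
have pointwise QP : normc2 (stft g f QP) <= 24 * K * fine F.
  rewrite -lee_fin (le_trans (normc2_stft_le QP mff mfg))//.
  rewrite (_ : 24 * K * fine F = 2 * (fine F * (12 * K))); last by ring.
  rewrite EFinM; apply: lee_wpmul2l => //.
  by rewrite EFinM fineK//; exact: lee_wpmul2l.
have M0 : 0 <= 24 * K * fine F by rewrite !mulr_ge0// fine_ge0.
have lhs_le : (CLnorm nu 2 (fun x => (\1_Omega x : R)%:C * stft g f (p x))%R ^+ 2 <=
    (24 * K * fine F)%:E * V)%E.
  rewrite CLnorm2_sqr /energy.
  apply: (@le_trans _ _ (\int[nu]_x ((24 * K * fine F)%:E * (\1_Omega x)%:E))%E).
    apply: ge0_le_integral_nonmeasurable => x; first by rewrite lee_fin normc2_ge0.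
    rewrite -EFinM lee_fin normc2M indicE.
    rewrite {1}/normc2/= expr0n/= addr0.
    by case: (x \in Omega); rewrite ?expr0n ?mul0r ?mulr0// expr1n mul1r mulr1.
  rewrite ge0_integralZl//; last first.
    by apply/measurable_EFinP; exact: measurable_indic.
  by rewrite integral_indic// setIT.
apply: (le_trans lhs_le).
have rhs0 : (0 <= D%:E * V * A * B)%E by rewrite !mule_ge0// lee_fin ltW.
(* If the transform of [f] has zero energy, so has the left-hand side. Otherwise neither weighted
   norm vanishes, so for [V > 0] an infinite norm makes the right-hand side infinite rather than a
   product [0 * +oo]. *)
have [->|F_neq0] := eqVneq (fine F) 0; first by rewrite mulr0 mul0e.
have fhh : is_fourier2 f (fourier f).
  have [//|e] := fourierP f.
  by move: F_neq0; rewrite /F e energy0 eqxx.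
have A_neq0 : A != 0%E.
  apply: contra_neq F_neq0 => Aeq0.
  have : energy mu f = 0%E.
    by apply: (energy_weight_eq0 alpha0 alphaQ mf); rewrite -CLnorm2_sqr -/A Aeq0 expe2 mule0.
  by move: FK => /[swap] ->; rewrite mule0 -/F => FK; apply/eqP; rewrite -eqe fineK// eq_le FK.
have B_neq0 : B != 0%E.
  apply: contra_neq F_neq0 => Beq0.
  rewrite /F (energy_weight_eq0 alpha0 alphaQ mff)//.
  by rewrite -CLnorm2_sqr -/B Beq0 expe2 mule0.
have [V_eq0|V_neq0] := eqVneq V 0%E; first by rewrite V_eq0 !mule0 !mul0e.
have gt0 (x : \bar R) : (0 <= x)%E -> x != 0%E -> (0 < x)%E.
  by move=> x0 xn0; rewrite lt0e xn0.
have {}A_neq0 := gt0 _ A0 A_neq0; have {}B_neq0 := gt0 _ B0 B_neq0.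
have {}V_neq0 := gt0 _ V0 V_neq0.
have DV0 : (0 < D%:E * V)%E by rewrite mule_gt0.
have [Ay|Ay] := eqVneq A +oo%E.
  by rewrite Ay gt0_muley// gt0_mulye// leey.
have [By|By] := eqVneq B +oo%E.
  by rewrite By gt0_muley ?leey// mule_gt0.
have fin (x : \bar R) : (0 <= x)%E -> x != +oo%E -> x \is a fin_num.
  by move=> x0 xy; rewrite ge0_fin_numE// lt_neqAle xy leey.
have /fineK aA := fin _ A0 Ay; have /fineK bB := fin _ B0 By.
set a := fine A in aA; set b := fine B in bB.
have a0 : 0 < a by rewrite -lte_fin aA.
have b0 : 0 < b by rewrite -lte_fin bB.
have ab0 : 0 < a / b by rewrite divr_gt0.
(* This radius balances the two terms: with [r ^ (2 alpha) = a / b] they become [C * a * b] and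
   [a * b]. *)
pose r := (a / b) `^ (2 * alpha)^-1.
have r0 : 0 < r by exact: powR_gt0.
have rp : r `^ (2 * alpha) = a / b.
  by rewrite /r -powRrM mulVf ?powRr1 ?(ltW ab0)// gt_eqF// mulr_gt0.
have Fab : fine F <= (C + 1) * a * b.
  rewrite -lee_fin fineK// (le_trans (unc _ _ fL fhh _ r0))//.
  rewrite -!CLnorm2_sqr -/A -/B -aA -bB powRN rp -!EFin_expe -!EFinM -EFinD lee_fin.
  rewrite le_eqVlt; apply/orP; left; apply/eqP; field.
  by rewrite !gt_eqF.
rewrite -aA -bB -[leRHS]muleA -EFinM muleAC -EFinM.
apply: lee_wpmul2r => //; rewrite lee_fin.
apply: (@le_trans _ _ (24 * K * ((C + 1) * a * b))).
  by apply: ler_wpM2l => //; rewrite mulr_ge0.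
rewrite -subr_ge0 /D (_ : _ - _ = a * b); last by ring.
by rewrite mulr_ge0// ltW.
Qed.

Unset Implicit Arguments.

Theorem theorem8p6 (R : realType) (n : nat) (alpha : R) :
  (1 <= n)%N -> 0 < alpha -> alpha < (homogeneous_dim n)%:R / 2 ->
  exists2 C : R, 0 < C &
    forall g : heisenberg R n -> R[i],
      inCLp (haar R n) 2 g -> CLnorm (haar R n) 2 g = 1%E ->
    forall Omega : set (heisenberg R n * heisenberg R n),
      lebesgue2_measurable Omega ->
    forall f : heisenberg R n -> R[i], inCLp (haar R n) 2 f ->
      (CLnorm (lebesgue2 R n) 2 (restrict_to Omega (stft g f)) ^+ 2 <=
       C%:E * lebesgue2 R n Omega
         * CLnorm (haar R n) 2 (koranyi_weight alpha f)
         * CLnorm (haar R n) 2 (koranyi_weight alpha (fourier f)))%E.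
Proof.
move=> _ alpha0 alphaQ.
have [C C0 CP] := stft_concentration alpha0 alphaQ.
exists C => // g gL g1 Omega mOmega f fL.
have bound := CP g gL g1 f fL.
apply: bound; exact mOmega.
Qed.
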